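(* Let $X=\mathbb{P}^1$ over the finite field $\mathbb{F}$ with $p$ elements, $K=\mathbb{F}(t)$, $\mathfrak{A}=\mathbb{M}_2(K)$, and fix a place $Q$ of degree $1$. For a place $P$ of $X$ let $N_P$ be the infinite matrix $\big(N_P(\mathfrak{D}_{iQ},\mathfrak{D}_{jQ})\big)_{i,j\in\mathbb{N}}$. Then for every place $P$ the matrix $N_P$ depends only on $d=\deg(P)$; writing $N_d$ for it (so $N_1=N_Q$) and setting $N_0=I$ (the identity matrix), for every $d\ge1$ $$N_d=N_1^d-\sum_{i=1}^{\lfloor d/2\rfloor}\binom{d}{i}p^iN_{d-2i}.$$
   Context: An $X$-order is a locally free subsheaf of $\mathcal{O}_X$-algebras of the constant sheaf $\mathfrak{A}$ with generic fibre $\mathfrak{A}$; maximal if maximal at every place; two are isomorphic if conjugate by an element of $\mathrm{GL}_2(K)$. For a divisor $B$, $\mathfrak{L}^B(V)=\{f\in K:\mathrm{div}(f)|_V+B|_V\ge0\}\cup\{0\}$ and $\mathfrak{D}_B=\begin{pmatrix}\mathcal{O}_X&\mathfrak{L}^B\\ \mathfrak{L}^{-B}&\mathcal{O}_X\end{pmatrix}$. For a place $P$, the local Bruhat–Tits tree $T_P$ has as vertices the maximal $\mathcal{O}_P$-orders of $\mathbb{M}_2(K_P)$, adjacent when in a suitable basis they are $\mathbb{M}_2(\mathcal{O}_P)$ and $\begin{pmatrix}\mathcal{O}_P&\pi_P^{-1}\mathcal{O}_P\\ \pi_P\mathcal{O}_P&\mathcal{O}_P\end{pmatrix}$. The $P$-neighbors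 of a maximal $X$-order $\mathfrak{D}$ are the maximal $X$-orders coinciding with $\mathfrak{D}$ at all places other than $P$ whose completion at $P$ is adjacent to $\mathfrak{D}_P$ in $T_P$; $N_P(\mathfrak{D},\mathfrak{D}')$ is the number of $P$-neighbors of $\mathfrak{D}$ isomorphic to $\mathfrak{D}'$. Products of these infinite matrices are computed entrywise as the usual (finite) sums. *)

(* Defs.v *)
From HB Require Import structures.
From mathcomp Require Import all_boot all_order all_algebra fraction.
From Stdlib Require Import ClassicalEpsilon.
Set Implicit Arguments. Unset Strict Implicit. Unset Printing Implicit Defensive.
Import Order.TTheory GRing.Theory Num.Theory.
Local Open Scope ring_scope.

Section Defs.
Variable p : nat.

Definition Fp := 'F_p.
Definition Fpoly := {poly 'F_p}.
Definition K := {fraction {poly 'F_p}}.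
Definition Mat := 'M[K]_2.

Definition tf (a : {poly 'F_p}) : K := @FracField.tofrac _ a.

(* Places of X = P^1 over F_p: [Some q] for q monic irreducible in F_p[t]
   (finite places), [None] for the place at infinity. *)
Definition is_place (P : option {poly 'F_p}) : Prop :=
  match P with
  | Some q => q \is monic /\ irreducible_poly q
  | None => True
  end.

Definition place_deg (P : option {poly 'F_p}) : nat :=
  match P with
  | Some q => (size q).-1
  | None => 1%N
  end.

Definition locO (P : option {poly 'F_p}) (f : K) : Prop :=
  match P with
  | Some q => exists a b : {poly 'F_p},
      b != 0 /\ ~~ (q %| b)%R /\ f = tf a / tf b
  | None => exists a b : {poly 'F_p},
      b != 0 /\ (size a <= size b)%N /\ f = tf a / tf b
  end.

Definition unif (P : option {poly 'F_p}) : K :=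
  match P with
  | Some q => tf q
  | None => (tf 'X)^-1
  end.

Definition inpow (P : option {poly 'F_p}) (n : int) (f : K) : Prop :=
  locO P (f * (unif P) ^ (- n)).

Definition mset := Mat -> Prop.
Definition mseteq (S T : mset) : Prop := forall x, S x <-> T x.
Definition msubset (S T : mset) : Prop := forall x, S x -> T x.

(* O_P-orders of M_2(K): O_P-lattices (finitely generated O_P-submodules
   spanning M_2(K) over K) which are subrings *)
Definition is_local_order (P : option {poly 'F_p}) (S : mset) : Prop :=
  [/\ [/\ S 1,
          (forall x y, S x -> S y -> S (x - y)) &
          (forall x y, S x -> S y -> S (x * y))],
      (forall (a : K) x, locO P a -> S x -> S (a *: x)),
      (exists s : seq Mat, (forall x, x \in s -> S x) /\
         forall x, S x -> exists c : 'I_(size s) -> K,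
           (forall i, locO P (c i)) /\ x = \sum_(i < size s) c i *: s`_i)
    & (forall m : Mat, exists a : K, a != 0 /\ S (a *: m))].

Definition is_local_max_order (P : option {poly 'F_p}) (S : mset) : Prop :=
  is_local_order P S /\
  forall T, is_local_order P T -> msubset S T -> mseteq T S.

Definition valmat (P : option {poly 'F_p}) (a b c d : int) : mset :=
  fun m => [/\ inpow P a (m 0 0), inpow P b (m 0 1),
               inpow P c (m 1 0) & inpow P d (m 1 1)].

Definition M2O (P : option {poly 'F_p}) : mset := valmat P 0 0 0 0.

(* adjacency in the Bruhat-Tits tree at P: in a suitable basis the two
   maximal orders are M_2(O_P) and [[O_P, pi^-1 O_P],[pi O_P, O_P]] *)
Definition tree_adj (P : option {poly 'F_p}) (S T : mset) : Prop :=
  exists g : Mat, g \in unitmx /\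
    mseteq S (fun x => M2O P (g * x * g^-1)) /\
    mseteq T (fun x => valmat P 0 (-1) 1 0 (g * x * g^-1)).

(* X-orders, described by their stalks D_P (P a place): a family of
   O_P-orders in M_2(K), equal to M_2(O_P) outside a finite set of places *)
Definition Xfam := option {poly 'F_p} -> mset.

Definition is_Xorder (D : Xfam) : Prop :=
  (forall P, is_place P -> is_local_order P (D P)) /\
  exists s : seq (option {poly 'F_p}),
    forall P, is_place P -> P \notin s -> mseteq (D P) (M2O P).

Definition is_max_Xorder (D : Xfam) : Prop :=
  is_Xorder D /\ forall P, is_place P -> is_local_max_order P (D P).

Definition Xeq (D D' : Xfam) : Prop :=
  forall P, is_place P -> mseteq (D P) (D' P).

Definition Xiso (D D' : Xfam) : Prop :=
  exists g : Mat, g \in unitmx /\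
    forall P, is_place P -> mseteq (D' P) (fun x => D P (g^-1 * x * g)).

Definition P_neighbor (P : option {poly 'F_p}) (D D' : Xfam) : Prop :=
  is_max_Xorder D' /\
  (forall R, is_place R -> R <> P -> mseteq (D' R) (D R)) /\
  tree_adj P (D P) (D' P).

Definition nthX (l : seq Xfam) (i : nat) : Xfam := nth (fun _ _ => False) l i.

Definition count_is (A : Xfam -> Prop) (n : nat) : Prop :=
  exists l : seq Xfam,
    [/\ size l = n,
        (forall i, (i < size l)%N -> A (nthX l i)),
        (forall i j, (i < size l)%N -> (j < size l)%N ->
            Xeq (nthX l i) (nthX l j) -> i = j)
      & (forall D, A D -> exists2 i, (i < size l)%N & Xeq D (nthX l i))].

Definition N_is (P : option {poly 'F_p}) (D D' : Xfam) (n : nat) : Prop :=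
  count_is (fun D'' => P_neighbor P D D'' /\ Xiso D'' D') n.

Definition D_iQ (Q : option {poly 'F_p}) (i : nat) : Xfam :=
  fun P => if P == Q then valmat P 0 (- (i%:Z)) (i%:Z) 0 else M2O P.

End Defs.

Definition imat := nat -> nat -> int.

Definition fsum (f : nat -> int) : int :=
  match excluded_middle_informative
          (exists M : nat, forall k, (M <= k)%N -> f k = 0) with
  | left h => let M := proj1_sig (constructive_indefinite_description _ h) in
              (\sum_(k < M) f k)%R
  | right _ => 0
  end.

Definition imul (A B : imat) : imat := fun i j => fsum (fun k => A i k * B k j).
Definition iid : imat := fun i j => (i == j)%:Z.
Fixpoint ipow (A : imat) (n : nat) : imat :=
  match n with 0 => iid | n'.+1 => imul (ipow A n') A end.

(* Main.v *)
Require Import Defs.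
From mathcomp Require Import all_boot all_order all_algebra fraction.
From mathcomp Require Import qpoly zify ring.
From Stdlib Require Import Classical ClassicalEpsilon.
Set Implicit Arguments. Unset Strict Implicit. Unset Printing Implicit Defensive.
Import GRing.Theory.
Local Open Scope ring_scope.

(** A maximal [X]-order is the endomorphism order of a lattice, given at each
    place by a matrix [a R] as [{x | a R x (a R)^-1 integral}].  Conjugation by
    [diag(y ^ i, 1)] carries [D_(iQ)] to [D_(i oo)] for every [Q] of degree one,
    so that only [Q = oo] has to be considered.

    The neighbors of [D_(i oo)] at a finite place [q] of degree [d] correspond to
    the points [l] of the projective line over [F_p[t] / q], through the lattices
    [{(u, v) | u + l v = 0 mod q}] and, for [l = oo], [{(u, v) | v = 0 mod q}].
    Reducing a basis with respect to the weight [max (deg u, deg v + i)] gives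
    successive minima [n1 <= n2] with [n1 + n2 = i + d], and the neighbor has type
    [n2 - n1].  A vector of small weight is a multiple of the first basis vector,
    and a nonzero one lies in exactly one of these lattices; counting the pairs of
    a lattice and a vector of weight less than [n] in two ways thus yields the
    number of lattices with a given [n1].

    The resulting matrices satisfy the relations which the identity
    [(z + p / z) ^ d = sum_k 'C(d, k) p ^ k z ^ (d - 2 k)] suggests: [N_1] is
    multiplication by [z + p / z] on the vertices [z ^ m] of a line folded onto the
    ray [0, 1, 2, ...], and [N_d], for [d >= 1], is multiplication by
    [z ^ d + (p / z) ^ d].  The formula is the binomial theorem with opposite
    terms collected. *)

(** * Orders over a discrete valuation ring *)

Section Conjugation.
Variables (F : fieldType) (n : nat).
Implicit Types (g h x : 'M[F]_n.+1).

Lemma unitmx_mulr g h : g \in unitmx -> h \in unitmx -> g * h \in unitmx.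
Proof. by move=> ug uh; rewrite unitmx_mul ug. Qed.

Lemma conjmxK g x : g \in unitmx -> g^-1 * (g * x * g^-1) * g = x.
Proof. by move=> ug; rewrite !mulrA mulVr // mul1r mulrVK. Qed.

Lemma conjmxVK g x : g \in unitmx -> g * (g^-1 * x * g) * g^-1 = x.
Proof. by move=> ug; rewrite !mulrA mulrV // mul1r mulrK. Qed.

Lemma invmx_conj_mul g h x : g \in unitmx -> h \in unitmx ->
  (h * g)^-1 * x * (h * g) = g^-1 * (h^-1 * x * h) * g.
Proof. by move=> ug uh; rewrite invrM // !mulrA. Qed.

End Conjugation.

Section DiscreteValuationRing.
Variables (F : fieldType) (O : F -> Prop) (pi : F).
Implicit Types (a b : F).

Record is_dvr : Prop := IsDvr {
  dvr1 : O 1;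
  dvrB : forall a b, O a -> O b -> O (a - b);
  dvrM : forall a b, O a -> O b -> O (a * b);
  unif_neq0 : pi != 0;
  dvr_unif : O pi;
  dvr_unifV : ~ O pi^-1;
  dvr_div_unif : forall a, O a -> ~ O (a / pi) -> O a^-1;
  dvr_bound : forall a, exists n, O (a * pi ^+ n)
}.

Hypothesis dvrO : is_dvr.

Lemma dvr0 : O 0.
Proof. by rewrite -(subrr 1); apply: (dvrB dvrO); apply: dvr1 dvrO. Qed.

Lemma dvrN a : O a -> O (- a).
Proof. by rewrite -sub0r; apply: (dvrB dvrO); apply: dvr0. Qed.

Lemma dvrD a b : O a -> O b -> O (a + b).
Proof. by move=> Oa Ob; rewrite -[b]opprK; apply: (dvrB dvrO) => //; apply: dvrN. Qed.

Lemma dvrX a n : O a -> O (a ^+ n).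
Proof.
move=> Oa; elim: n => [|n IHn]; first exact: dvr1 dvrO.
by rewrite exprS; apply: (dvrM dvrO).
Qed.

Lemma dvr_sum (I : Type) (r : seq I) (f : I -> F) :
  (forall i, O (f i)) -> O (\sum_(i <- r) f i).
Proof. by move=> Of; apply: big_ind => //; [exact: dvr0 | exact: dvrD]. Qed.

Lemma dvr_prod (I : Type) (r : seq I) (f : I -> F) :
  (forall i, O (f i)) -> O (\prod_(i <- r) f i).
Proof.
move=> Of; apply: big_ind => //; first exact: dvr1 dvrO.
by move=> *; apply: (dvrM dvrO).
Qed.

Lemma dvr_total a : O a \/ O a^-1.
Proof.
have [n] := dvr_bound dvrO a; elim: n => [|n IHn]; first by rewrite mulr1; left.
have [/IHn//|nOn OSn] := classic (O (a * pi ^+ n)); right.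
have pi0 := unif_neq0 dvrO; have piS0 : pi ^+ n.+1 != 0 by rewrite expf_neq0.
have OV : O (a * pi ^+ n.+1)^-1.
  by apply: (dvr_div_unif dvrO) => //; rewrite exprSr mulrA mulfK.
rewrite -[a^-1](mulfK piS0) -mulrA mulrC -mulrA -invfM [_ * a]mulrC.
by apply: (dvrM dvrO) => //; apply/dvrX/(dvr_unif dvrO).
Qed.

Lemma min_valuation_mem (s : seq F) a0 : a0 != 0 ->
  exists m, [/\ m \in a0 :: s, m != 0 & {in a0 :: s, forall a, O (a / m)}].
Proof.
move=> a00; elim: s => [|a s [m [ms m0 Om]]].
  exists a0; rewrite mem_head; split=> // _ /[1!inE] /eqP->.
  by rewrite divff //; exact: dvr1 dvrO.
have mem b : (b \in [:: a0, a & s]) = (b == a) || (b \in a0 :: s).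
  by rewrite !inE orbCA.
have [Oam|Oma] := dvr_total (a / m).
  exists m; split=> //; first by rewrite mem ms orbT.
  by move=> b; rewrite mem => /predU1P[->|/Om].
have [a0'|a0'] := eqVneq a 0.
  exists m; split=> //; first by rewrite mem ms orbT.
  by move=> b; rewrite mem => /predU1P[->|/Om//]; rewrite a0' mul0r; exact: dvr0.
exists a; split=> //; first by rewrite mem eqxx.
move=> b; rewrite mem => /predU1P[->|/Om Ob].
  by rewrite divff //; exact: dvr1 dvrO.
have -> : b / a = (b / m) * (a / m)^-1 by field; rewrite a0' m0.
exact: (dvrM dvrO).
Qed.

End DiscreteValuationRing.

Section MatrixOrders.
Variables (F : fieldType) (O : F -> Prop) (pi : F).
Hypothesis dvrO : is_dvr O pi.

Definition intM m n (A : 'M[F]_(m, n)) : Prop := forall i j, O (A i j).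

Lemma intM_mul m n r (A : 'M_(m, n)) (B : 'M_(n, r)) :
  intM A -> intM B -> intM (A *m B).
Proof.
move=> iA iB i j; rewrite mxE; apply: (dvr_sum dvrO) => k.
exact: (dvrM dvrO).
Qed.

Lemma intM_delta m n i j : intM (delta_mx i j : 'M_(m, n)).
Proof.
by move=> k l; rewrite mxE; case: (_ && _); [exact: dvr1 dvrO | exact: dvr0 dvrO].
Qed.

Lemma intM_det n (A : 'M_n) : intM A -> O (\det A).
Proof.
move=> iA; apply: (dvr_sum dvrO) => s; apply: (dvrM dvrO).
  by apply: (dvrX dvrO); apply/(dvrN dvrO)/(dvr1 dvrO).
by apply: (dvr_prod dvrO).
Qed.

Lemma intM_adj n (A : 'M_n) : intM A -> intM (\adj A).
Proof.
move=> iA i j; rewrite mxE; apply: (dvrM dvrO).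
  by apply: (dvrX dvrO); apply/(dvrN dvrO)/(dvr1 dvrO).
by apply: intM_det => k l; rewrite !mxE.
Qed.

Section SquareMatrices.
Variable n : nat.
Implicit Types (a k : F) (g h x : 'M[F]_n.+1).

Definition intGL g : Prop := [/\ g \in unitmx, intM g & intM g^-1].

Lemma intGL_det g : intGL g <-> [/\ intM g, \det g != 0 & O (\det g)^-1].
Proof.
split=> [[ug ig iVg]|[ig det0 Odet]].
  by split=> //; [rewrite -unitfE -unitmxE | rewrite -det_inv; exact: intM_det].
have ug : g \in unitmx by rewrite unitmxE unitfE.
split=> // i j; rewrite [g^-1]/(invmx g) /invmx ug mxE.
by apply: (dvrM dvrO) => //; exact: intM_adj.
Qed.

Lemma intM1 : intM (1 : 'M[F]_n.+1).
Proof.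
by move=> i j; rewrite mxE; case: (_ == _); [exact: dvr1 dvrO | exact: dvr0 dvrO].
Qed.

Lemma intGL1 : intGL 1.
Proof. by split; rewrite ?unitmx1 ?invr1 //; exact: intM1. Qed.

Definition scaledGL g : Prop := exists2 k, k != 0 & intGL (k *: g).

Lemma intGL_scaled g : intGL g -> scaledGL g.
Proof. by exists 1; rewrite ?oner_neq0 // scale1r. Qed.

Lemma scaledGLZ k g : k != 0 -> scaledGL g -> scaledGL (k *: g).
Proof.
move=> k0 [e e0 GLe]; exists (e / k); first by rewrite mulf_neq0 ?invr_eq0.
by rewrite scalerA divfK.
Qed.

Lemma scaledGL_unit g : scaledGL g -> g \in unitmx.
Proof. by case=> k k0 [+ _ _]; rewrite unitmxZ ?unitfE. Qed.

Lemma scaledGL_det1 g : scaledGL g -> \det g = 1 -> intGL g.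
Proof.
move=> [k k0 GLk] det1; have [ik _ Odet] := (intGL_det _).1 GLk.
have := intM_det ik; rewrite detZ det1 mulr1 => Okn.
rewrite detZ det1 mulr1 in Odet.
have OkV : O k^-1.
  have [Ok|//] := dvr_total dvrO k.
  have -> : k^-1 = (k ^+ n.+1)^-1 * k ^+ n.
    by rewrite exprSr invfM mulrAC mulVf ?mul1r ?expf_neq0.
  by apply: (dvrM dvrO) => //; exact: (dvrX dvrO).
apply/intGL_det; rewrite det1 oner_neq0 invr1; split=> // [i j|]; last exact: dvr1 dvrO.
by have := dvrM dvrO OkV (ik i j); rewrite mxE mulKf.
Qed.

Definition conj_order g : 'M[F]_n.+1 -> Prop := fun x => intM (g * x * g^-1).

Lemma conj_orderM g h x : g \in unitmx -> h \in unitmx ->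
  conj_order (g * h) x <-> conj_order g (h * x * h^-1).
Proof. by move=> ug uh; rewrite /conj_order invrM // !mulrA. Qed.

Lemma conj_order_intGL g x : intGL g -> conj_order g x <-> intM x.
Proof.
move=> [ug ig iVg]; split=> [ix|ix]; last by apply: intM_mul => //; exact: intM_mul.
rewrite -(conjmxK x ug).
by apply: intM_mul => //; exact: intM_mul.
Qed.

Lemma conj_orderZ k g x : k != 0 -> g \in unitmx ->
  conj_order (k *: g) x <-> conj_order g x.
Proof.
move=> k0 ug; rewrite /conj_order invrZ ?unitfE //.
by rewrite -!scalerAl -scalerAr scalerA divff // scale1r.
Qed.

Lemma conj_order_scaledGL g x : scaledGL g -> conj_order g x <-> intM x.
Proof.
move=> sg; have ug := scaledGL_unit sg; case: sg => k k0 GLk.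
by rewrite -(conj_orderZ x k0 ug); exact: conj_order_intGL.
Qed.

(* Scale [g] so that its entries are integral and [g k l = 1]; then the entries
   of [g^-1] occur among those of [g *m delta_mx l i *m g^-1]. *)
Lemma normalizer_intM g : g \in unitmx ->
  (forall x, intM x -> conj_order g x) -> scaledGL g.
Proof.
move=> ug norm.
have /existsP[[i0 j0] /= gij0] : [exists ij : 'I_n.+1 * 'I_n.+1, g ij.1 ij.2 != 0].
  apply: contraLR ug => /existsPn g0; suff -> : g = 0 by rewrite unitmxE det0 unitr0.
  by apply/matrixP=> i j; apply/eqP; have := g0 (i, j); rewrite negbK mxE.
have [m [mg m0 Om]] :=
  min_valuation_mem dvrO [seq g ij.1 ij.2 | ij : 'I_n.+1 * 'I_n.+1] gij0.
have [[k l] gkl] : exists kl, m = g kl.1 kl.2.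
  by move: mg; rewrite inE => /predU1P[->|/codomP[kl ->]]; [exists (i0, j0) | exists kl].
have mV0 : m^-1 != 0 by rewrite invr_eq0.
have Og i j : O (g i j / m).
  by apply: Om; rewrite inE; apply/orP; right; apply/codomP; exists (i, j).
have ugm : m^-1 *: g \in unitmx by rewrite unitmxZ ?unitfE.
exists m^-1 => //; split=> // i j; first by rewrite mxE mulrC.
have := norm _ (intM_delta l i); rewrite -(conj_orderZ _ mV0 ug) => /(_ k j).
have -> : ((m^-1 *: g) * delta_mx l i * (m^-1 *: g)^-1) k j =
    \sum_r (m^-1 * g k l * (i == r)%:R) * (m^-1 *: g)^-1 r j.
  rewrite mxE; apply: eq_bigr => r _; congr (_ * _); rewrite mxE (bigD1 l) //=.
  by rewrite !mxE eqxx big1 ?addr0 1?eq_sym // => s sl; rewrite !mxE (negPf sl) mulr0.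
rewrite gkl mulVf -?gkl // (bigD1 i) //= eqxx !mul1r big1 ?addr0 // => r ri.
by rewrite eq_sym (negPf ri) mulr0 mul0r.
Qed.

Lemma conj_order_sub g h : g \in unitmx -> h \in unitmx ->
  (forall x, conj_order g x -> conj_order h x) -> scaledGL (h * g^-1).
Proof.
move=> ug uh sub; have uVg : g^-1 \in unitmx by rewrite unitmx_inv.
apply: normalizer_intM => [|x ix]; first by rewrite unitmx_mul uh.
by apply/conj_orderM => //; apply: sub; rewrite invrK /conj_order conjmxVK.
Qed.

Lemma conj_order_eq g h : g \in unitmx -> h \in unitmx ->
  (forall x, conj_order g x <-> conj_order h x) <-> scaledGL (h * g^-1).
Proof.
move=> ug uh; split=> [eq_gh|GL x].
  by apply: conj_order_sub => // x; rewrite eq_gh.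
have -> : conj_order h x <-> conj_order (h * g^-1) (g * x * g^-1).
  by rewrite -conj_orderM ?(scaledGL_unit GL) // mulrVK.
exact: iff_sym (conj_order_scaledGL _ GL).
Qed.

End SquareMatrices.
End MatrixOrders.

Section MaximalOrders.
Variables (F : fieldType) (O : F -> Prop) (pi : F) (n : nat).
Hypothesis dvrO : is_dvr O pi.
Implicit Types (a : F) (g x y m : 'M[F]_n.+1).

(* [is_order (locO P)] unfolds to [is_local_order P]. *)
Definition is_order (S : 'M[F]_n.+1 -> Prop) : Prop :=
  [/\ [/\ S 1,
          (forall x y, S x -> S y -> S (x - y)) &
          (forall x y, S x -> S y -> S (x * y))],
      (forall a x, O a -> S x -> S (a *: x)),
      (exists s : seq 'M[F]_n.+1, (forall x, x \in s -> S x) /\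
         forall x, S x -> exists c : 'I_(size s) -> F,
           (forall i, O (c i)) /\ x = \sum_(i < size s) c i *: s`_i)
    & (forall m, exists a : F, a != 0 /\ S (a *: m))].

Lemma common_denominator (s : seq F) : exists N, {in s, forall a, O (a * pi ^+ N)}.
Proof.
have OX r : O (pi ^+ r) by apply/(dvrX dvrO)/(dvr_unif dvrO).
elim: s => [|a s [N ON]]; first by exists 0.
have [M OM] := dvr_bound dvrO a; exists (M + N)%N => b /[1!inE] /predU1P[->|/ON Ob].
  by rewrite exprD mulrA; apply: (dvrM dvrO).
by rewrite addnC exprD mulrA; apply: (dvrM dvrO).
Qed.

Lemma is_order_intM : is_order (intM O (n := n.+1)).
Proof.
split; first split.
- exact: intM1 dvrO _.
- by move=> x y ix iy i j; rewrite !mxE; exact: dvrB dvrO _ _ (ix i j) (iy i j).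
- by move=> x y; exact: (intM_mul dvrO).
- by move=> a x Oa ix i j; rewrite mxE; apply: (dvrM dvrO).
- pose ids := index_enum ('I_n.+1 * 'I_n.+1)%type.
  exists [seq delta_mx ij.1 ij.2 | ij <- ids]; split=> [_ /mapP[ij _ ->]|x ix].
    exact: intM_delta dvrO _ _ _ _.
  exists (fun r => let ij := nth (0, 0) ids r in x ij.1 ij.2).
  split=> [r|]; first exact: ix.
  rewrite {1}[x]matrix_sum_delta pair_bigA (big_nth (0, 0)) big_mkord size_map.
  by apply: eq_bigr => r _; rewrite (nth_map (0, 0)).
- move=> m.
  have [N ON] := common_denominator [seq m ij.1 ij.2 | ij : 'I_n.+1 * 'I_n.+1].
  exists (pi ^+ N); split; first by rewrite expf_neq0 // (unif_neq0 dvrO).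
  by move=> i j; rewrite mxE mulrC; apply: ON; apply/codomP; exists (i, j).
Qed.

Lemma is_order_conj S g : g \in unitmx -> is_order S ->
  is_order (fun x => S (g * x * g^-1)).
Proof.
move=> ug [[S1 SB SM] SZ [s [sS gen]] span].
pose conjV x := g^-1 * x * g.
split.
- split; first by rewrite mulr1 mulrV.
    by move=> x y Sx Sy; rewrite mulrBr mulrBl; apply: SB.
  move=> x y Sx Sy; suff -> : g * (x * y) * g^-1 = (g * x * g^-1) * (g * y * g^-1).
    exact: SM.
  by rewrite !mulrA mulrVK.
- by move=> a x Oa Sx; rewrite -scalerAr -scalerAl; apply: SZ.
- exists (map conjV s); split=> [_ /mapP[x xs ->]|x /gen[c [Oc xE]]].
    by rewrite (conjmxVK x ug); exact: sS.
  move: c Oc xE; rewrite -(size_map conjV) => c Oc xE; exists c; split=> //.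
  rewrite -(conjmxK x ug) xE mulr_sumr mulr_suml; apply: eq_bigr => i _.
  rewrite -scalerAr -scalerAl (nth_map 0) //.
  by have := ltn_ord i; rewrite {2}size_map.
- move=> m; have [a [a0 Sa]] := span (g * m * g^-1).
  by exists a; split=> //; rewrite -scalerAr -scalerAl.
Qed.

Lemma bounded_powers_dvr f r : (forall e, O (f ^+ e * pi ^+ r)) -> O f.
Proof.
move=> Ofm; have [//|OfV] := dvr_total dvrO f.
have [->|f0] := eqVneq f 0; first exact: dvr0 dvrO.
apply: NNPP => nOf; apply: (dvr_unifV dvrO).
have Ou : O (f^-1 / pi) by apply: NNPP => /(dvr_div_unif dvrO OfV); rewrite invrK.
have p0 := unif_neq0 dvrO.
have -> : pi^-1 = f ^+ r.+1 * pi ^+ r * (f^-1 / pi) ^+ r.+1.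
  rewrite exprMn mulrACA -exprMn divff // expr1n mul1r exprS exprVn.
  by rewrite mulrCA divff ?expf_neq0 ?mulr1.
by apply: (dvrM dvrO) => //; apply: (dvrX dvrO).
Qed.

Lemma order_entries_bounded T i j : is_order T ->
  exists r, forall y, T y -> O (y i j * pi ^+ r).
Proof.
case=> _ _ [s [_ gen]] _.
have [r Or] := common_denominator [seq y i j | y : 'M[F]_n.+1 <- s].
exists r => _ /gen[c [Oc ->]]; rewrite summxE mulr_suml; apply: (dvr_sum dvrO) => k.
by rewrite mxE -mulrA; apply: (dvrM dvrO) => //; apply/Or/map_f/mem_nth.
Qed.

Lemma mul_delta_delta (i j k l : 'I_n.+1) x :
  delta_mx i k * x * delta_mx l j = x k l *: delta_mx i j :> 'M[F]_n.+1.
Proof.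
apply/matrixP=> r s; rewrite !mxE (bigD1 l) //= big1 => [|t tl]; last first.
  by rewrite !mxE (negPf tl) mulr0.
rewrite !mxE (bigD1 k) //= big1 => [|t tk]; last by rewrite !mxE (negPf tk) andbF mul0r.
by rewrite !mxE !eqxx andbT addr0 addr0 [RHS]mulrC mulrAC -natrM mulnb.
Qed.

(* A ring which contains [intM] and a matrix with entry [f] contains all
   [f ^+ m *: delta_mx 0 0], whereas finite generation bounds denominators. *)
Lemma intM_maximal T : is_order T -> (forall x, intM O x -> T x) ->
  forall x, T x -> intM O x.
Proof.
move=> oT sub x Tx i j; have [[_ _ TM] _ _ _] := oT.
have Tdelta k l : T (delta_mx k l) by apply/sub/(intM_delta dvrO).
have [r Or] := order_entries_bounded 0 0 oT; apply: (@bounded_powers_dvr _ r) => e.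
suff /Or : T (x i j ^+ e *: delta_mx 0 0) by rewrite !mxE !eqxx mulr1.
elim: e => [|e IHe]; first by rewrite scale1r.
have -> : x i j ^+ e.+1 *: delta_mx 0 0 =
    (delta_mx 0 i * x * delta_mx j 0) * (x i j ^+ e *: delta_mx 0 0) :> 'M[F]_n.+1.
  rewrite mul_delta_delta -scalerAr -scalerAl [delta_mx _ _ * _]mul_delta_mx.
  by rewrite scalerA exprSr.
by apply: (TM) => //; apply: (TM) => //; exact: (TM).
Qed.

Lemma is_order_conj_order g : g \in unitmx -> is_order (conj_order O g).
Proof. by move=> ug; apply: is_order_conj ug is_order_intM. Qed.

Lemma conj_order_maximal g T : g \in unitmx -> is_order T ->
  (forall x, conj_order O g x -> T x) -> forall x, T x <-> conj_order O g x.
Proof.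
move=> ug oT sub x; split=> [Tx|/sub//].
have uVg : g^-1 \in unitmx by rewrite unitmx_inv.
apply: (intM_maximal (is_order_conj uVg oT)) => [y iy|]; rewrite invrK.
  by apply: sub; rewrite /conj_order conjmxVK.
by rewrite conjmxK.
Qed.

End MaximalOrders.

(** * Neighbors in the Bruhat-Tits tree *)

Section TwoByTwo.
Variable R : comNzRingType.
Implicit Types (a b c d k : R) (x y : 'M[R]_2).

Definition mx2 a b c d : 'M[R]_2 :=
  \matrix_(i, j) if i == 0 then (if j == 0 then a else b)
                 else (if j == 0 then c else d).

Definition diag2 a : 'M[R]_2 := mx2 a 0 0 1.

Lemma ord2P (P : 'I_2 -> Prop) : P 0 -> P 1 -> forall i, P i.
Proof.
by move=> P0 P1 [[|[|//]] lt_i]; [move: P0 | move: P1];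
  congr P; apply: val_inj.
Qed.

Lemma mx2E a b c d : (mx2 a b c d 0 0 = a) * (mx2 a b c d 0 1 = b) *
  (mx2 a b c d 1 0 = c) * (mx2 a b c d 1 1 = d).
Proof. by rewrite !mxE. Qed.

Lemma mx2_eta x : x = mx2 (x 0 0) (x 0 1) (x 1 0) (x 1 1).
Proof. by apply/matrixP; apply: ord2P; apply: ord2P; rewrite mx2E. Qed.

Lemma mx2_inj a b c d a' b' c' d' :
  mx2 a b c d = mx2 a' b' c' d' -> [/\ a = a', b = b', c = c' & d = d'].
Proof.
by move/matrixP=> e; split;
  [have := e 0 0 | have := e 0 1 | have := e 1 0 | have := e 1 1]; rewrite !mx2E.
Qed.

Lemma mx2M a b c d a' b' c' d' : mx2 a b c d * mx2 a' b' c' d' =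
  mx2 (a * a' + b * c') (a * b' + b * d') (c * a' + d * c') (c * b' + d * d').
Proof.
by rewrite [LHS]mx2_eta !mxE !big_ord_recl !big_ord0 !mxE !addr0.
Qed.

Lemma mx2_1 : 1 = mx2 1 0 0 1.
Proof. by rewrite [LHS]mx2_eta !mxE. Qed.

Lemma mx2Z k a b c d : k *: mx2 a b c d = mx2 (k * a) (k * b) (k * c) (k * d).
Proof. by rewrite [LHS]mx2_eta !mxE. Qed.

Lemma det_mx2 a b c d : \det (mx2 a b c d) = a * d - b * c.
Proof.
rewrite (expand_det_row _ 0) !big_ord_recl big_ord0 /cofactor !det_mx11 !mxE /=; ring.
Qed.

Lemma diag2M a b : diag2 a * diag2 b = diag2 (a * b).
Proof. by rewrite /diag2 mx2M; congr mx2; ring. Qed.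

Lemma det_diag2 a : \det (diag2 a) = a.
Proof. by rewrite det_mx2; ring. Qed.

(* [None] stands for the point at infinity of the projective line over [R / pi]. *)
Definition nbr_mx (L : Type) (rep : L -> R) (pi : R) (o : option L) : 'M[R]_2 :=
  if o is Some l then mx2 1 (rep l) 0 pi else diag2 pi.

Lemma det_nbr_mx (L : Type) (rep : L -> R) pi o : \det (nbr_mx rep pi o) = pi.
Proof. by case: o => [l|]; rewrite ?det_diag2 // det_mx2; ring. Qed.

End TwoByTwo.

Lemma map_mx2 (R S : comNzRingType) (f : {rmorphism R -> S}) a b c d :
  map_mx f (mx2 a b c d) = mx2 (f a) (f b) (f c) (f d).
Proof. by rewrite [LHS]mx2_eta !mxE. Qed.

Lemma unitmx_diag2 (F : fieldType) (a : F) : a != 0 -> diag2 a \in unitmx.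
Proof. by rewrite unitmxE det_diag2 unitfE. Qed.

Lemma diag2V (F : fieldType) (a : F) : a != 0 -> (diag2 a)^-1 = diag2 a^-1.
Proof.
move=> a0; apply: (mulrI (unitmx_diag2 a0)).
by rewrite mulrV ?unitmx_diag2 // diag2M divff // mx2_1.
Qed.

Section Neighbors.
Variables (F : fieldType) (O : F -> Prop) (pi : F).
Hypothesis dvrO : is_dvr O pi.
Implicit Types (m r x : 'M[F]_2).

Lemma intM_mx2 a b c d : O a -> O b -> O c -> O d -> intM O (mx2 a b c d).
Proof. by move=> *; apply: ord2P; apply: ord2P; rewrite mx2E. Qed.

Lemma intGL_diag2 a : a != 0 -> O a -> O a^-1 -> intGL O (diag2 a).
Proof.
move=> a0 Oa OaV; apply/(intGL_det dvrO); rewrite det_diag2; split=> //.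
by apply: intM_mx2 => //; [exact: dvr0 dvrO | exact: dvr0 dvrO | exact: dvr1 dvrO].
Qed.

Lemma conj_order_diag2 n x : conj_order O (diag2 (pi ^+ n)) x <->
  [/\ O (x 0 0), O (x 0 1 * pi ^+ n), O (x 1 0 / pi ^+ n) & O (x 1 1)].
Proof.
have p0 : pi ^+ n != 0 by rewrite expf_neq0 // (unif_neq0 dvrO).
rewrite /conj_order diag2V // {1}[x]mx2_eta /diag2 !mx2M.
rewrite (_ : mx2 _ _ _ _ = mx2 (x 0 0) (x 0 1 * pi ^+ n) (x 1 0 / pi ^+ n) (x 1 1)).
  split=> [ix|[]]; last exact: intM_mx2.
  by split; [have := ix 0 0 | have := ix 0 1 | have := ix 1 0 | have := ix 1 1];
    rewrite mx2E.
by congr mx2; field.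
Qed.

Variables (L : Type) (rep : L -> F).
Hypothesis rep_int : forall l, O (rep l).
Hypothesis rep_surj : forall f, O f -> exists l, O ((f - rep l) / pi).
Hypothesis rep_inj : forall l l', O ((rep l - rep l') / pi) -> l = l'.
Notation nbr := (nbr_mx rep pi).

Lemma unitmx_nbr o : nbr o \in unitmx.
Proof. by rewrite unitmxE det_nbr_mx unitfE (unif_neq0 dvrO). Qed.

Lemma intGL_nbr_quotient r m o : intGL O r -> intM O m ->
  diag2 pi * r = m * nbr o -> intGL O (diag2 pi * r * (nbr o)^-1).
Proof.
move=> /(intGL_det dvrO)[_ det0 Odet] im rE.
rewrite rE mulrK ?unitmx_nbr //; apply/(intGL_det dvrO).
suff -> : \det m = \det r by [].
have /(congr1 determinant) := rE; rewrite !det_mulmx det_diag2 det_nbr_mx mulrC.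
by move/(mulIf (unif_neq0 dvrO)).
Qed.

(* Only the bottom row of [r] modulo [pi] matters: it is a point of the
   projective line over the residue field, and [rep] lists its affine part. *)
Lemma nbr_mx_surj r : intGL O r -> exists o, intGL O (diag2 pi * r * (nbr o)^-1).
Proof.
move=> GLr; have [_ ir _] := GLr; have p0 := unif_neq0 dvrO.
have [[r0 Or]|nr] := classic (r 1 0 != 0 /\ O (r 1 0)^-1).
  have [l Ol] := rep_surj (dvrM dvrO (ir 1 1) Or); exists (Some l).
  apply: (@intGL_nbr_quotient _ (mx2 (pi * r 0 0) (r 0 1 - r 0 0 * rep l)
    (r 1 0) (r 1 0 * ((r 1 1 / r 1 0 - rep l) / pi)))) => //.
    apply: intM_mx2 => //; [| | exact: (dvrM dvrO)].
      by apply: (dvrM dvrO) => //; exact: dvr_unif dvrO.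
    by apply: (dvrB dvrO) => //; exact: (dvrM dvrO).
  by rewrite {1}[r]mx2_eta /diag2 !mx2M; congr mx2; field; rewrite ?r0 ?p0.
have Or : O (r 1 0 / pi).
  have [->|r0] := eqVneq (r 1 0) 0; first by rewrite mul0r; exact: dvr0 dvrO.
  by apply: NNPP => nO; apply: nr; split=> //; exact: (dvr_div_unif dvrO).
exists None.
apply: (@intGL_nbr_quotient _ (mx2 (r 0 0) (pi * r 0 1) (r 1 0 / pi) (r 1 1))) => //.
  by apply: intM_mx2 => //; apply: (dvrM dvrO) => //; exact: dvr_unif dvrO.
by rewrite {1}[r]mx2_eta /nbr_mx /diag2 !mx2M; congr mx2; field.
Qed.

Lemma nbr_mx_double_coset o :
  exists2 r, intGL O r & intGL O (diag2 pi * r * (nbr o)^-1).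
Proof.
have O0 := dvr0 dvrO; have O1 := dvr1 dvrO.
case: o => [l|]; last first.
  by exists 1; [|rewrite mulr1 mulrV ?(unitmx_nbr None)//]; exact: (intGL1 dvrO).
have GLr : intGL O (mx2 0 1 1 (rep l)).
  apply/(intGL_det dvrO); rewrite det_mx2 mul0r mulr1 sub0r oppr_eq0 oner_neq0 invrN1.
  by split=> //; [exact: intM_mx2 | exact: (dvrN dvrO)].
exists (mx2 0 1 1 (rep l)) => //.
apply: (@intGL_nbr_quotient _ (mx2 0 1 1 0)) => //; first exact: intM_mx2.
by rewrite /diag2 !mx2M; congr mx2; ring.
Qed.

Lemma nbr_mx_inj o o' : scaledGL O (nbr o' * (nbr o)^-1) -> o = o'.
Proof.
set m := nbr o' * _ => sm; have p0 := unif_neq0 dvrO.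
have mE : m * nbr o = nbr o' by rewrite mulrVK ?unitmx_nbr.
have [_ im _] : intGL O m.
  apply: (scaledGL_det1 dvrO) => //; apply: (mulIf p0).
  by have /(congr1 determinant) := mE; rewrite det_mulmx !det_nbr_mx mul1r.
move: mE (im 0 0) (im 0 1) (im 1 1); rewrite [m]mx2_eta !mx2E.
move: (m 0 0) (m 0 1) (m 1 0) (m 1 1) => a b c d.
case: o {m sm im} => [l|]; case: o' => [l'|] //;
  rewrite /nbr_mx /diag2 mx2M => /mx2_inj[] e1 e2 e3 e4 Oa Ob Od.
- congr Some; apply/esym/rep_inj; move: e1 e2; rewrite mulr1 mulr0 addr0 => -> <-.
  by move: Ob; congr O; field.
- case: (dvr_unifV dvrO); move: e3 e4; rewrite mulr1 mulr0 addr0 => ->.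
  by rewrite mul0r add0r => /(canRL (mulfK p0)) dE; move: Od; rewrite dE mul1r.
- case: (dvr_unifV dvrO); move: e1; rewrite mulr0 addr0 => /(canRL (mulfK p0)) aE.
  by move: Oa; rewrite aE mul1r.
Qed.

Let nbr_quotient (a r : 'M[F]_2) o : a \in unitmx -> r \in unitmx ->
  diag2 pi * (r * a) * (nbr o * a)^-1 = diag2 pi * r * (nbr o)^-1.
Proof. by move=> ua ur; rewrite invrM ?unitmx_nbr // !mulrA mulrK. Qed.

Let unitmx_diag2_mul (g : 'M[F]_2) : g \in unitmx -> diag2 pi * g \in unitmx.
Proof. by rewrite unitmx_mul unitmx_diag2 ?(unif_neq0 dvrO). Qed.

Let unitmx_nbr_mul o (g : 'M[F]_2) : g \in unitmx -> nbr o * g \in unitmx.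
Proof. by rewrite unitmx_mul unitmx_nbr. Qed.

Lemma conj_order_nbr_adj a o : a \in unitmx -> exists g, [/\ g \in unitmx,
  forall x, conj_order O a x <-> conj_order O g x &
  forall x, conj_order O (nbr o * a) x <-> conj_order O (diag2 pi * g) x].
Proof.
move=> ua; have [r GLr GLo] := nbr_mx_double_coset o; have [ur _ _] := GLr.
have ura : r * a \in unitmx by rewrite unitmx_mul ur.
exists (r * a); split=> //;
  apply/(conj_order_eq dvrO); rewrite ?unitmx_nbr_mul ?unitmx_diag2_mul //.
  by rewrite mulrK //; exact: intGL_scaled.
by rewrite nbr_quotient //; exact: intGL_scaled.
Qed.

Lemma conj_order_nbr_surj a g : a \in unitmx -> g \in unitmx ->
  (forall x, conj_order O a x <-> conj_order O g x) ->
  exists o, forall x, conj_order O (diag2 pi * g) x <-> conj_order O (nbr o * a) x.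
Proof.
move=> ua ug /(conj_order_eq dvrO ua ug)[k k0 GLr].
set r := k *: _ in GLr; have [ur _ _] := GLr.
have gE : g = k^-1 *: (r * a) by rewrite /r -scalerAl scalerK // mulrVK.
have [o GLo] := nbr_mx_surj GLr; exists o => x; apply: iff_sym; move: x.
apply/(conj_order_eq dvrO); rewrite ?unitmx_nbr_mul ?unitmx_diag2_mul //.
rewrite gE -scalerAr -scalerAl nbr_quotient //.
by apply: scaledGLZ; rewrite ?invr_eq0 //; exact: intGL_scaled.
Qed.

Lemma conj_order_nbr_inj a o o' : a \in unitmx ->
  (forall x, conj_order O (nbr o * a) x <-> conj_order O (nbr o' * a) x) -> o = o'.
Proof.
move=> ua /(conj_order_eq dvrO (unitmx_nbr_mul o ua) (unitmx_nbr_mul o' ua)) s.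
by apply: nbr_mx_inj; move: s; rewrite invrM ?unitmx_nbr // mulrA mulrK.
Qed.

End Neighbors.

(** * Local rings of the rational function field *)

Section PolynomialDivisibility.
Variable k : fieldType.
Implicit Types (a b c q r : {poly k}).

(* [lia] does not identify the [size] of [size_mul] and [dvdp_leq], whose
   ring structure is inherited from [idomainType], with that of the goals. *)
Lemma size_polyM a b : a != 0 -> b != 0 -> size (a * b) = (size a + size b).-1.
Proof. exact: size_mul. Qed.

Lemma dvdp_size_leq a b : b != 0 -> a %| b -> (size a <= size b)%N.
Proof. exact: dvdp_leq. Qed.

Lemma size_polyM_leq a b m n :
  (size a <= m)%N -> (size b <= n)%N -> (size (a * b)%R <= (m + n).-1)%N.
Proof. by move=> am bn; apply: leq_trans (size_polyMleq _ _) _; lia. Qed.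

Lemma size_polyB_leq a b n :
  (size a <= n)%N -> (size b <= n)%N -> (size (a - b)%R <= n)%N.
Proof.
by move=> an bn; apply: leq_trans (size_polyD _ _) _; rewrite size_polyN geq_max an.
Qed.

Lemma size_irredp q : irreducible_poly q -> size q = (size q).-1.+1.
Proof. by case=> q1 _; rewrite prednK // ltnW. Qed.

Lemma irreducible_dvd1 q : irreducible_poly q -> (q %| 1) = false.
Proof. by case=> q1 _; rewrite dvdp1 gtn_eqF. Qed.

Lemma irreducible_dvdM q a b : irreducible_poly q ->
  (q %| a * b) = (q %| a) || (q %| b).
Proof.
move=> irr; have [qa|nqa] /= := boolP (q %| a); first by rewrite dvdp_mulr.
by rewrite Gauss_dvdpr // irreducible_poly_coprime.
Qed.

Lemma monic_irreducible_eq r q : r \is monic -> irreducible_poly r ->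
  q \is monic -> irreducible_poly q -> r %| q -> r = q.
Proof.
move=> mr [r1 _] mq iq rq; apply/eqP; rewrite -eqp_monic //.
by apply: (apply_irredp iq) rq; rewrite gtn_eqF.
Qed.

Lemma dvdp_small_eq0 q a : (size a < size q)%N -> q %| a -> a = 0.
Proof.
move=> aq qa; apply/eqP; apply: contraLR aq => a0.
by rewrite -leqNgt dvdp_size_leq.
Qed.

Lemma coprime_power_factor q b : (1 < size q)%N -> b != 0 ->
  exists n (c : {poly k}), b = c * q ^+ n /\ ~~ (q %| c).
Proof.
move=> q1; have q0 : q != 0 by rewrite -size_poly_gt0 ltnW.
have [n] := ubnP (size b); elim: n b => // n IHn b sb b0.
have [/dvdpP[c bE]|nqb] := boolP (q %| b); last by exists 0, b; rewrite mulr1.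
have c0 : c != 0 by apply: contraNneq b0 => c0; rewrite bE c0 mul0r.
have [|//|m [e [cE nqe]]] := IHn c; last first.
  by exists m.+1, e; rewrite exprSr mulrA -cE.
move: sb; rewrite bE size_polyM //; have : (0 < size c)%N by rewrite size_poly_gt0.
lia.
Qed.

Lemma irreducible_factor b : (1 < size b)%N ->
  exists q, [/\ q \is monic, irreducible_poly q & q %| b].
Proof.
have [n] := ubnP (size b); elim: n b => // n IHn b sb b1.
have b0 : b != 0 by rewrite -size_poly_gt0 ltnW.
have [[d [d1 db ndb]]|nfact] :=
    classic (exists d : {poly k}, [/\ size d != 1, d %| b & ~~ (d %= b)]).
  have d0 : d != 0 by apply: contraTneq db => ->; rewrite dvd0p.
  have [||q [mq iq qd]] := IHn d.
  - have db_size : size d != size b by rewrite dvdp_size_eqp.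
    by have := dvdp_size_leq b0 db; lia.
  - by rewrite ltn_neqAle eq_sym d1 size_poly_gt0.
  by exists q; split=> //; exact: dvdp_trans qd db.
have lb0 : lead_coef b != 0 by rewrite lead_coef_eq0.
have e : (lead_coef b)^-1 *: b %= b by rewrite eqp_scale // invr_eq0.
exists ((lead_coef b)^-1 *: b); split; last by rewrite (eqp_dvdl _ e).
  by rewrite monicE lead_coefZ mulVf.
split=> [|d d1]; first by rewrite (eqp_size e).
rewrite (eqp_dvdr _ e) (eqp_rtrans e) => db.
by apply: contraT => ndb; case: nfact; exists d.
Qed.

End PolynomialDivisibility.

Section RationalFunctions.
Variables (k F : fieldType) (t : {rmorphism {poly k} -> F}).
Hypothesis t_eq0 : forall a, (t a == 0) = (a == 0).
Hypothesis t_frac : forall f, exists (a b : {poly k}), b != 0 /\ f = t a / t b.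
Implicit Types (a b c d l q r : {poly k}) (f : F).

Definition finO q f :=
  exists (a b : {poly k}), b != 0 /\ ~~ (q %| b) /\ f = t a / t b.
Definition infO f :=
  exists (a b : {poly k}), b != 0 /\ (size a <= size b)%N /\ f = t a / t b.

Let t_neq0 a : a != 0 -> t a != 0. Proof. by rewrite t_eq0. Qed.

Lemma frac_eq a b c d : b != 0 -> d != 0 -> t a / t b = t c / t d -> a * d = c * b.
Proof.
move=> b0 d0 /eqP; rewrite eqr_div ?t_neq0 // -!rmorphM -subr_eq0 -rmorphB t_eq0.
by rewrite subr_eq0 => /eqP.
Qed.

Lemma fracB a b c d : b != 0 -> d != 0 ->
  t a / t b - t c / t d = t (a * d - c * b) / t (b * d).
Proof. by move=> b0 d0; rewrite rmorphB !rmorphM /=; field; rewrite !t_neq0. Qed.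

Lemma fracM a b c d : (t a / t b) * (t c / t d) = t (a * c) / t (b * d).
Proof. by rewrite !rmorphM mulf_div. Qed.

Lemma fracMr a b q : q != 0 -> t (a * q) / t (b * q) = t a / t b.
Proof. by move=> q0; rewrite !rmorphM -mulf_div divff ?mulr1 // t_neq0. Qed.

Lemma frac1 a : t a = t a / t 1.
Proof. by rewrite rmorph1 divr1. Qed.

Lemma finO_frac q a b : ~~ (q %| b) -> finO q (t a / t b).
Proof.
by move=> nqb; exists a, b; split=> //; apply: contraNneq nqb => ->; exact: dvdp0.
Qed.

Lemma finO_poly q a : irreducible_poly q -> finO q (t a).
Proof. by move=> irr; rewrite frac1; apply: finO_frac; rewrite irreducible_dvd1. Qed.

Lemma finO_dvr q : irreducible_poly q -> is_dvr (finO q) (t q).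
Proof.
move=> irr; have q0 := irredp_neq0 irr; have [q1 _] := irr; split.
- by rewrite -(rmorph1 t); exact: finO_poly.
- move=> _ _ [a [b [b0 [nqb ->]]]] [c [d [d0 [nqd ->]]]]; rewrite fracB //.
  by apply: finO_frac; rewrite irreducible_dvdM // negb_or nqb.
- move=> _ _ [a [b [b0 [nqb ->]]]] [c [d [d0 [nqd ->]]]]; rewrite fracM.
  by apply: finO_frac; rewrite irreducible_dvdM // negb_or nqb.
- exact: t_neq0.
- exact: finO_poly.
- rewrite -[_^-1]mul1r -(rmorph1 t) => -[a [b [b0 [/negP nqb /(frac_eq q0 b0) e]]]].
  by case: nqb; rewrite -[b]mul1r e dvdp_mull.
- move=> _ [a [b [b0 [nqb ->]]]]; rewrite invf_div => nO; apply: finO_frac.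
  apply/negP => /dvdpP[c aE]; case: nO; rewrite aE rmorphM.
  by rewrite mulrAC mulfK ?t_neq0 //; exact: finO_frac.
- move=> f; have [a [b [b0 ->]]] := t_frac f.
  have [m [d [bE nqd]]] := coprime_power_factor q1 b0; exists m.
  have -> : t a / t b * t q ^+ m = t a / t d; last exact: finO_frac.
  by rewrite -(fracMr a d (expf_neq0 m q0)) -bE rmorphM rmorphXn mulrAC.
Qed.

Lemma infO_frac a b : b != 0 -> infO (t a / t b) <-> (size a <= size b)%N.
Proof.
move=> b0; split=> [[c [d [d0 [scd /(frac_eq b0 d0) E]]]]|]; last by exists a, b.
have [->|a0] := eqVneq a 0; first by rewrite size_poly0.
have c0 : c != 0.
  by apply/eqP => c0; move/eqP: E; rewrite c0 mul0r mulf_eq0 (negPf a0) (negPf d0).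
have /(congr1 (fun r : {poly k} => size r)) := E; rewrite !size_polyM //.
by move: a0 b0 c0 d0; rewrite -!size_poly_gt0; lia.
Qed.

Lemma infO_Xn a n : infO (t a / t 'X^n) <-> (size a <= n.+1)%N.
Proof. by rewrite infO_frac ?expf_neq0 ?polyX_eq0 // size_polyXn. Qed.

Lemma infO_dvr : is_dvr infO (t 'X)^-1.
Proof.
split.
- by rewrite -(rmorph1 t) frac1; apply/infO_frac; rewrite ?oner_neq0.
- move=> _ _ [a [b [b0 [sb ->]]]] [c [d [d0 [sd ->]]]]; rewrite fracB //.
  apply/infO_frac; rewrite ?mulf_neq0 // (size_polyM b0 d0) //.
  by apply: size_polyB_leq; [|rewrite addnC]; exact: size_polyM_leq.
- move=> _ _ [a [b [b0 [sb ->]]]] [c [d [d0 [sd ->]]]]; rewrite fracM.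
  by apply/infO_frac; rewrite ?mulf_neq0 // (size_polyM b0 d0) // size_polyM_leq.
- by rewrite invr_eq0 t_neq0 ?polyX_eq0.
- by rewrite -[_^-1]mul1r -(rmorph1 t); apply/infO_frac;
    rewrite ?polyX_eq0 ?size_poly1 ?size_polyX.
- by rewrite invrK frac1 infO_frac ?oner_neq0 // size_poly1 size_polyX.
- move=> _ [a [b [b0 [sb ->]]]]; rewrite invrK [t 'X]frac1 fracM mulr1 invf_div.
  rewrite infO_frac // => nsz.
  have a0 : a != 0 by apply/eqP => a0; case: nsz; rewrite a0 mul0r size_poly0.
  by move: nsz; rewrite size_mulX // => nsz; apply/infO_frac => //; lia.
- move=> f; have [a [b [b0 ->]]] := t_frac f; exists (size a).
  rewrite exprVn -rmorphXn /= -mulrA -invfM -rmorphM.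
  apply/infO_frac; rewrite ?mulf_neq0 ?expf_neq0 ?polyX_eq0 // size_mulXn //.
  exact: leq_addr.
Qed.

Lemma finO_residue_surj q f : irreducible_poly q -> finO q f ->
  exists l, (size l <= (size q).-1)%N /\ finO q ((f - t l) / t q).
Proof.
move=> irr [a [b [b0 [nqb ->]]]]; have q0 := irredp_neq0 irr.
have /Bezout_eq1_coprimepP[[u v] /= uv] : coprimep q b.
  by rewrite irreducible_poly_coprime.
exists ((a * v) %% q); split; first by rewrite -ltnS -(size_irredp irr) ltn_modp.
have /dvdpP[c e] : q %| a - (a * v) %% q * b.
  have -> : a - (a * v) %% q * b = a * u * q + (a * v - (a * v) %% q) * b.
    by rewrite -{1}[a]mulr1 -uv; ring.
  apply: dvdp_add; first exact: dvdp_mulIr.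
  by apply: dvdp_mulr; rewrite {1}(divp_eq (a * v) q) addrK dvdp_mulIr.
have -> : (t a / t b - t ((a * v) %% q)) / t q = t c / t b; last exact: finO_frac.
rewrite [t (_ %% _)]frac1 fracB ?oner_neq0 // mulr1 e mulr1 rmorphM.
by rewrite mulrAC mulfK // t_neq0.
Qed.

Lemma finO_residue_inj q l : irreducible_poly q ->
  (size l <= (size q).-1)%N -> finO q (t l / t q) -> l = 0.
Proof.
move=> irr sl [a [b [b0 [nqb /(frac_eq (irredp_neq0 irr) b0) E]]]].
apply: (@dvdp_small_eq0 _ q); first by rewrite (size_irredp irr).
have : q %| l * b by rewrite E dvdp_mull.
by rewrite irreducible_dvdM // (negPf nqb) orbF.
Qed.

Lemma infO_residue_surj f : infO f ->
  exists l, (size l <= 1)%N /\ infO ((f - t l) / (t 'X)^-1).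
Proof.
move=> [a [b [b0 [sab ->]]]]; have sb : (0 < size b)%N by rewrite size_poly_gt0.
pose l : {poly k} := (a`_(size b).-1 / lead_coef b)%:P.
have sl : (size l <= 1)%N by exact: size_polyC_leq1.
have sz : (size (a - l * b)%R < size b)%N.
  rewrite -[X in (_ < X)%N](prednK sb) ltnS; apply/leq_sizeP => j.
  rewrite leq_eqVlt coefB coefCM => /predU1P[<-|lt_j].
    by rewrite -lead_coefE divfK ?subrr // lead_coef_eq0.
  have bj : (size b <= j)%N by lia.
  by rewrite (nth_default 0 bj) (nth_default 0 (leq_trans sab bj)) mulr0 subr0.
move: l sl sz => l sl sz; exists l; split=> //.
have -> : (t a / t b - t l) / (t 'X)^-1 = t ((a - l * b) * 'X) / t b.
  by rewrite invrK rmorphM rmorphB rmorphM /=; field; rewrite t_neq0.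
apply/infO_frac => //; have [->|n0] := eqVneq (a - l * b) 0.
  by rewrite mul0r size_poly0.
by rewrite size_mulX.
Qed.

Lemma infO_residue_inj l : (size l <= 1)%N -> infO (t l / (t 'X)^-1) -> l = 0.
Proof.
move=> sl; rewrite invrK -rmorphM frac1 infO_frac ?oner_neq0 // size_poly1.
by apply: contraTeq => l0; rewrite size_mulX // -ltnNge ltnS size_poly_gt0.
Qed.

Lemma finO_everywhere_poly f :
  (forall q, q \is monic -> irreducible_poly q -> finO q f) -> exists a, f = t a.
Proof.
move=> Of; have [a [b [b0 fE]]] := t_frac f.
have [n] := ubnP (size b); elim: n a b b0 fE => // n IHn a b b0 fE sb.
have [b1|b1] := leqP (size b) 1.
  have bE := size1_polyC b1; rewrite bE polyC_eq0 in b0.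
  exists ((b`_0)^-1 *: a); rewrite fE {1}bE; apply: (canLR (mulfK _)).
    by rewrite t_neq0 ?polyC_eq0.
  by rewrite -rmorphM mulrC mul_polyC scalerKV.
have [q [mq iq /dvdpP[b' bE]]] := irreducible_factor b1.
have q0 := irredp_neq0 iq; have q1 : (1 < size q)%N by case: iq.
have b'0 : b' != 0 by apply: contraNneq b0 => b'0; rewrite bE b'0 mul0r.
have [c [d [d0 [nqd e]]]] := Of q mq iq.
have /dvdpP[a' aE] : q %| a.
  have : q %| a * d by rewrite (frac_eq b0 d0 (etrans (esym fE) e)) bE mulrA dvdp_mull.
  by rewrite irreducible_dvdM // (negPf nqd) orbF.
apply: (IHn a' b') => //; first by rewrite fE aE bE fracMr.
by move: sb; rewrite bE size_polyM //; lia.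
Qed.

Lemma intGL_finO n q (A : 'M[{poly k}]_n.+1) : irreducible_poly q ->
  ~~ (q %| \det A) -> intGL (finO q) (map_mx t A).
Proof.
move=> irr nq; apply/(intGL_det (finO_dvr irr)); rewrite det_map_mx t_eq0.
split=> [i j||]; first by rewrite mxE; exact: finO_poly.
  by apply: contraNneq nq => ->; rewrite dvdp0.
by rewrite -[_^-1]mul1r -(rmorph1 t); exact: finO_frac.
Qed.

End RationalFunctions.

(** * Families of local orders on the projective line *)

Lemma fraction_div (R : idomainType) (f : {fraction R}) :
  exists a b : R, b != 0 /\ f = FracField.tofrac a / FracField.tofrac b.
Proof.
elim/quotW: f => -[[a b] /= b0]; exists a, b; split=> //.
apply: (canRL (mulfK _)); first by rewrite tofrac_eq0.
unlock FracField.tofrac; rewrite -[LHS]FracField.pi_mul; apply/eqmodP.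
rewrite /= FracField.equivfE /FracField.mulf /= !numden_Ratio ?mulr1 ?oner_neq0 //.
by rewrite mulrC.
Qed.

Section Places.
Variable p : nat.
Implicit Types (P R : option {poly 'F_p}) (f : K p) (x g h : Mat p) (S T : mset p).

Definition tfm : {rmorphism {poly 'F_p} -> K p} := @FracField.tofrac {poly 'F_p}.

Lemma tfm_eq0 (a : {poly 'F_p}) : (tfm a == 0) = (a == 0).
Proof. exact: tofrac_eq0. Qed.

Lemma tfm_frac f : exists a b : {poly 'F_p}, b != 0 /\ f = tfm a / tfm b.
Proof. exact: fraction_div. Qed.

Lemma place_dvr P : is_place P -> is_dvr (locO P) (unif P).
Proof.
case: P => [q [_ irr]|_]; first exact: (finO_dvr tfm_eq0 tfm_frac irr).
exact: (infO_dvr tfm_eq0 tfm_frac).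
Qed.

Lemma unif_place_neq0 P : is_place P -> unif P != 0.
Proof. by move/place_dvr/unif_neq0. Qed.

Definition place_rep P (l : {poly_(place_deg P) 'F_p}) : K p := tfm (val l).

Lemma place_rep_int P l : is_place P -> locO P (@place_rep P l).
Proof.
case: P l => [q|] l /=; first by case=> _ irr; exact: (finO_poly tfm).
move=> _; have := size_npoly l; rewrite /place_rep frac1 => sl.
by apply/(infO_frac tfm_eq0); rewrite ?oner_neq0 // size_poly1.
Qed.

Lemma place_rep_surj P f : is_place P -> locO P f ->
  exists l, locO P ((f - @place_rep P l) / unif P).
Proof.
case: P => [q|] /=.
  by move=> [_ irr] /(finO_residue_surj tfm_eq0 irr)[l [sl Ol]]; exists (NPoly sl).
by move=> _ /(infO_residue_surj tfm_eq0)[l [sl Ol]]; exists (NPoly sl).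
Qed.

Lemma place_rep_inj P l l' : is_place P ->
  locO P ((@place_rep P l - place_rep l') / unif P) -> l = l'.
Proof.
move=> plP; rewrite /place_rep -rmorphB => Oll.
have sl : (size (val l - val l')%R <= place_deg P)%N.
  by apply: size_polyB_leq; exact: size_npoly.
apply/val_inj/eqP; rewrite -subr_eq0; apply/eqP.
case: P plP l l' sl Oll => [q [_ irr]|_] l l' sl Oll.
  exact: (finO_residue_inj tfm_eq0 irr sl Oll).
exact: (infO_residue_inj tfm_eq0 sl Oll).
Qed.

Lemma valmatE P (n : nat) x : is_place P ->
  valmat P 0 (- n%:Z) n%:Z 0 x <-> conj_order (locO P) (diag2 (unif P ^+ n)) x.
Proof.
move=> plP; apply: iff_trans (iff_sym (conj_order_diag2 (place_dvr plP) n x)).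
by rewrite /valmat /inpow oppr0 expr0z !mulr1 opprK -exprnN.
Qed.

Lemma M2OE P x : M2O P x <-> intM (locO P) x.
Proof.
rewrite /M2O /valmat /inpow oppr0 expr0z !mulr1; split=> [[]|ix]; last by split.
by rewrite {5}[x]mx2_eta; exact: intM_mx2.
Qed.

Lemma tree_adjE P S T : is_place P -> tree_adj P S T <->
  exists g, [/\ g \in unitmx, mseteq S (conj_order (locO P) g) &
    mseteq T (conj_order (locO P) (diag2 (unif P) * g))].
Proof.
move=> plP; have ud := unitmx_diag2 (unif_place_neq0 plP).
have diagE g x (ug : g \in unitmx) : valmat P 0 (-1) 1 0 (g * x * g^-1) <->
    conj_order (locO P) (diag2 (unif P) * g) x.
  exact: iff_trans (valmatE 1 _ plP) (iff_sym (conj_orderM _ _ ud ug)).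
split=> [[g [ug [eS eT]]]|[g [ug eS eT]]]; exists g.
  split=> [|x|x]; first exact: ug.
    exact: iff_trans (eS x) (M2OE P _).
  exact: iff_trans (eT x) (diagE g x ug).
split; first exact: ug.
split=> x; first exact: iff_trans (eS x) (iff_sym (M2OE P _)).
exact: iff_trans (eT x) (iff_sym (diagE g x ug)).
Qed.

Lemma Xeq_Xiso (D D' : Xfam p) : Xeq D D' -> Xiso D D'.
Proof.
move=> e; exists 1; split=> [|R plR x]; first exact: unitmx1.
rewrite invr1 mul1r mulr1; exact: iff_sym (e R plR x).
Qed.

Lemma Xiso_sym (D D' : Xfam p) : Xiso D D' -> Xiso D' D.
Proof.
case=> g [ug e]; exists g^-1; split=> [|R plR x]; first by rewrite unitmx_inv.
rewrite invrK; apply: iff_sym; apply: iff_trans (e R plR _) _.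
by rewrite [X in D _ X](conjmxK x ug).
Qed.

Lemma Xiso_trans (D1 D2 D3 : Xfam p) : Xiso D1 D2 -> Xiso D2 D3 -> Xiso D1 D3.
Proof.
case=> g [ug e1] [h [uh e2]]; exists (h * g); split=> [|R plR x].
  exact: unitmx_mulr uh ug.
apply: iff_trans (e2 R plR x) _.
rewrite [X in D1 _ X](invmx_conj_mul x ug uh); exact: e1 R plR _.
Qed.

Definition fam (a : option {poly 'F_p} -> Mat p) : Xfam p :=
  fun R => conj_order (locO R) (a R).

Definition adelic (a : option {poly 'F_p} -> Mat p) : Prop :=
  (forall R, is_place R -> a R \in unitmx) /\
  exists s : seq (option {poly 'F_p}),
    forall R, is_place R -> R \notin s -> intGL (locO R) (a R).

Definition nbr_at (a : option {poly 'F_p} -> Mat p) P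
    (o : option {poly_(place_deg P) 'F_p}) : option {poly 'F_p} -> Mat p :=
  fun R => if R == P then nbr_mx (@place_rep P) (unif P) o * a P else a R.

Lemma fam_max a : adelic a -> is_max_Xorder (fam a).
Proof.
move=> [ua [s GLs]]; split; last first.
  move=> R plR; split; first exact: (is_order_conj_order (place_dvr plR) (ua R plR)).
  by move=> T oT sub x; exact: (conj_order_maximal (place_dvr plR) (ua R plR) oT sub).
split=> [R plR|]; first exact: (is_order_conj_order (place_dvr plR) (ua R plR)).
exists s => R plR Rs x; rewrite M2OE.
exact: (conj_order_intGL (place_dvr plR) x (GLs R plR Rs)).
Qed.

Lemma unitmx_nbr_at a P o R : is_place P -> is_place R ->
  (forall R, is_place R -> a R \in unitmx) -> @nbr_at a P o R \in unitmx.
Proof.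
move=> plP plR ua; rewrite /nbr_at; case: ifP => _; last exact: ua.
apply: unitmx_mulr (ua P plP); exact: (unitmx_nbr (place_dvr plP)).
Qed.

Lemma adelic_nbr_at a P o : is_place P -> adelic a -> adelic (@nbr_at a P o).
Proof.
move=> plP [ua [s GLs]]; split=> [R plR|]; first exact: unitmx_nbr_at.
exists (P :: s) => R plR; rewrite inE negb_or /nbr_at => /andP[/negPf-> ]; exact: GLs.
Qed.

Lemma fam_nbr_at_off a P o R : R <> P -> fam (@nbr_at a P o) R = fam a R.
Proof. by rewrite /fam /nbr_at => /eqP/negPf->. Qed.

Section Neighbor.
Variables (P : option {poly 'F_p}) (a : option {poly 'F_p} -> Mat p) (D : Xfam p).
Hypotheses (plP : is_place P) (adelic_a : adelic a) (D_fam : Xeq D (fam a)).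

Let dvrP := place_dvr plP.
Let uaP : a P \in unitmx. Proof. by have [ua _] := adelic_a; exact: ua. Qed.

Lemma P_neighbor_nbr_at o : P_neighbor P D (fam (@nbr_at a P o)).
Proof.
split; first exact/fam_max/adelic_nbr_at.
split=> [R plR RP x|]; first by rewrite fam_nbr_at_off // D_fam.
have [g [ug eg eo]] := conj_order_nbr_adj dvrP (fun l => place_rep_int l plP) o uaP.
apply/tree_adjE; [exact: plP | exists g; split=> [|x|x]].
- exact: ug.
- exact: iff_trans (D_fam plP x) (eg x).
- by rewrite /fam /nbr_at eqxx; exact: eo.
Qed.

Lemma P_neighbor_surj D' : P_neighbor P D D' -> exists o, Xeq D' (fam (@nbr_at a P o)).
Proof.
case=> _ [off /(tree_adjE _ _ plP)[g [ug eS eT]]].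
have [x|o eo] := conj_order_nbr_surj dvrP (fun l => place_rep_int l plP)
  (fun f => place_rep_surj plP) uaP ug.
  exact: iff_trans (iff_sym (D_fam plP x)) (eS x).
exists o => R plR x; have [->|/eqP RP] := eqVneq R P.
  by rewrite /fam /nbr_at eqxx; exact: iff_trans (eT x) (eo x).
by rewrite fam_nbr_at_off //; exact: iff_trans (off R plR RP x) (D_fam plR x).
Qed.

Lemma nbr_at_inj o o' : Xeq (fam (@nbr_at a P o)) (fam (nbr_at a o')) -> o = o'.
Proof.
move=> /(_ P plP); rewrite /fam /nbr_at eqxx.
by apply: (conj_order_nbr_inj dvrP) => // l l'; exact: place_rep_inj.
Qed.

Lemma N_is_card D' (pr : pred (option {poly_(place_deg P) 'F_p})) :
  (forall o, Xiso (fam (nbr_at a o)) D' <-> pr o) -> N_is P D D' #|pr|.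
Proof.
move=> prP; exists [seq fam (nbr_at a o) | o <- enum pr]; rewrite size_map -cardE.
have nthE i (lti : (i < #|pr|)%N) : nthX [seq fam (nbr_at a o) | o <- enum pr] i =
    fam (nbr_at a (enum_val (Ordinal lti))).
  rewrite /nthX (nth_map None); last by rewrite -cardE.
  by rewrite (enum_val_nth None).
split=> [//|i lti|i j lti ltj|D'' [nbD'' isoD'']].
- rewrite nthE; split; first exact: P_neighbor_nbr_at.
  by apply/prP; exact: (enum_valP (Ordinal lti)).
- by rewrite !nthE => /nbr_at_inj/enum_val_inj[].
- have [o eo] := P_neighbor_surj nbD''.
  have pro : o \in pr by apply/prP/(Xiso_trans _ isoD'')/Xiso_sym/Xeq_Xiso.
  have lto := ltn_ord (enum_rank_in pro o); exists (enum_rank_in pro o) => //.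
  rewrite (nthE _ lto) (_ : Ordinal lto = enum_rank_in pro o) ?enum_rankK_in //.
  exact: val_inj.
Qed.

End Neighbor.

Lemma Xiso_famP a b : (forall R, is_place R -> a R \in unitmx) ->
  (forall R, is_place R -> b R \in unitmx) ->
  Xiso (fam a) (fam b) <-> exists2 g, g \in unitmx &
    forall R, is_place R -> scaledGL (locO R) (a R * g * (b R)^-1).
Proof.
move=> ua ub.
have isoE g R : g \in unitmx -> is_place R ->
    (forall x, fam b R x <-> fam a R (g * x * g^-1)) <->
    scaledGL (locO R) (a R * g * (b R)^-1).
  move=> ug plR; have uag : a R * g \in unitmx by exact: unitmx_mulr (ua R plR) ug.
  apply: iff_trans (conj_order_eq (place_dvr plR) (ub R plR) uag).
  have agE x := conj_orderM (locO R) x (ua R plR) ug.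
  split=> e x; first exact: iff_trans (e x) (iff_sym (agE x)).
  exact: iff_trans (e x) (agE x).
split=> [[g [ug e]]|[g ug e]].
  have uVg : g^-1 \in unitmx by rewrite unitmx_inv.
  exists g^-1 => [|R plR]; first exact: uVg.
  by apply/(isoE _ R uVg plR) => x; rewrite invrK; exact: e R plR x.
exists g^-1; split=> [|R plR x]; first by rewrite unitmx_inv.
by rewrite invrK; exact: (isoE _ R ug plR).2 (e R plR) x.
Qed.

End Places.

(** * Reduced lattice bases *)

Section TopCoefficients.
Variable k : fieldType.
Implicit Types (a b : {poly k}).

Lemma coefM_top a b m n :
  (size a <= m.+1)%N -> (size b <= n.+1)%N -> (a * b)`_(m + n) = a`_m * b`_n.
Proof.
move=> am bn; have mn : (m < (m + n).+1)%N by rewrite ltnS leq_addr.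
rewrite coefM (bigD1 (Ordinal mn)) //= addKn big1 ?addr0 // => j /eqP nj.
have [jm|mj|e] := ltngtP (nat_of_ord j) m; last by case: nj; apply: val_inj.
  by rewrite [b`__]nth_default ?mulr0 //; apply: leq_trans bn _; lia.
by rewrite [a`__]nth_default ?mul0r //; apply: leq_trans am _.
Qed.

Lemma size_leq_coef0 a n : (size a <= n.+1)%N -> a`_n = 0 -> (size a <= n)%N.
Proof.
move=> an a0; apply/leq_sizeP => j; rewrite leq_eqVlt => /predU1P[<-//|nj].
by rewrite nth_default // (leq_trans an).
Qed.

Lemma size_XnM_leq n a m : (size ('X^n * a)%R <= m)%N = (size a <= m - n)%N.
Proof.
have [->|a0] := eqVneq a 0; first by rewrite mulr0 size_poly0.
have := a0; rewrite mulrC size_mulXn // -size_poly_gt0; lia.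
Qed.

Lemma cancel_top a b m n (c : k) : (m <= n)%N -> (size a <= m.+1)%N ->
  (size b <= n.+1)%N -> b`_n = c * a`_m -> (size (b - c *: 'X^(n - m) * a)%R <= n)%N.
Proof.
move=> mn sa sb top; apply: size_leq_coef0; last first.
  by rewrite coefB -scalerAl coefZ coefXnM ltnNge leq_subr /= subKn // top subrr.
apply: size_polyB_leq => //; rewrite -scalerAl (leq_trans (size_scale_leq _ _)) //.
by rewrite size_XnM_leq; lia.
Qed.

Lemma proportional_pairs (x1 y1 x2 y2 : k) : x1 * y2 = x2 * y1 ->
  ~~ ((x1 == 0) && (y1 == 0)) -> exists c, x2 = c * x1 /\ y2 = c * y1.
Proof.
move=> e; have [x10|x10] /= := eqVneq x1 0 => [y10|_].
  exists (y2 / y1); rewrite divfK // x10 mulr0; split=> //; apply/eqP.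
  by move/eqP: e; rewrite x10 mul0r eq_sym mulf_eq0 (negPf y10) orbF.
by exists (x2 / x1); rewrite divfK // mulrAC -e mulrAC divff // mul1r.
Qed.

End TopCoefficients.

Section ReducedBases.
Variables (k : fieldType) (q : {poly k}) (d i : nat).
Hypothesis sizeq : size q = d.+1.
Implicit Types (f u v : {poly k}) (o : option {poly_d k}).

Definition in_lattice o u v : bool :=
  if o is Some l then q %| u + val l * v else q %| v.

(* [u / t ^ n] and [t ^ i v / t ^ n] vanish at infinity. *)
Definition short n u v : bool := (size u <= n)%N && (size ('X^i * v)%R <= n)%N.

Inductive has_basis o n1 n2 : Prop :=
  HasBasis u1 v1 u2 v2 (c : k) of in_lattice o u1 v1 & in_lattice o u2 v2 &
    c != 0 & u1 * v2 - u2 * v1 = c *: q & short n1.+1 u1 v1 & short n2.+1 u2 v2.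

Definition reduced_basis o n1 n2 : Prop :=
  [/\ (n1 <= n2)%N, (n1 + n2 = i + d)%N & has_basis o n1 n2].

Lemma in_latticeM o f u v : in_lattice o u v -> in_lattice o (f * u) (f * v).
Proof. by case: o => [l|] /= quv; rewrite ?(mulrCA _ f) -?mulrDr dvdp_mull. Qed.

Lemma in_latticeB o u v u' v' :
  in_lattice o u v -> in_lattice o u' v' -> in_lattice o (u - u') (v - v').
Proof.
case: o => [l|] /= quv quv'; last exact: dvdp_sub.
by rewrite mulrBr addrACA -opprD; exact: dvdp_sub.
Qed.

Lemma in_lattice_det o u v u' v' :
  in_lattice o u v -> in_lattice o u' v' -> q %| u * v' - u' * v.
Proof.
case: o => [l|] /= quv quv'; last by rewrite dvdp_sub ?dvdp_mull.
have -> : u * v' - u' * v = (u + val l * v) * v' - (u' + val l * v') * v by ring.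
by rewrite dvdp_sub ?dvdp_mulr.
Qed.

Lemma has_basisC o n1 n2 : has_basis o n1 n2 -> has_basis o n2 n1.
Proof.
case=> u1 v1 u2 v2 c L1 L2 c0 det s1 s2.
by apply: (@HasBasis _ _ _ u2 v2 u1 v1 (- c)); rewrite ?oppr_eq0 // scaleNr -det opprB.
Qed.

Lemma basis_det_neq0 (c : k) : c != 0 -> c *: q != 0.
Proof. by move=> c0; rewrite scale_poly_eq0 negb_or c0 -size_poly_gt0 sizeq. Qed.

Lemma basis_top_coefs n1 n2 u1 v1 u2 v2 (c : k) : (i + d < n1 + n2)%N ->
  u1 * v2 - u2 * v1 = c *: q -> short n1.+1 u1 v1 -> short n2.+1 u2 v2 ->
  u1`_n1 * ('X^i * v2)`_n2 = u2`_n2 * ('X^i * v1)`_n1.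
Proof.
move=> n12 det /andP[su1 sv1] /andP[su2 sv2]; apply/eqP; rewrite -subr_eq0.
rewrite -(coefM_top su1 sv2) -(coefM_top su2 sv1) [(n2 + n1)%N]addnC -coefB.
rewrite !(mulrCA _ 'X^i) -mulrBr det coefXnM -coefXnM.
rewrite nth_default // size_XnM_leq; apply: leq_trans (size_scale_leq _ _) _.
by rewrite sizeq; lia.
Qed.

Lemma shorten_first o n1 n2 u1 v1 u2 v2 (c : k) :
  in_lattice o u1 v1 -> in_lattice o u2 v2 -> c != 0 -> u1 * v2 - u2 * v1 = c *: q ->
  short n1.+1 u1 v1 -> short n2.+1 u2 v2 -> u1`_n1 = 0 -> ('X^i * v1)`_n1 = 0 ->
  exists2 m, n1 = m.+1 & has_basis o m n2.
Proof.
move=> L1 L2 c0 det /andP[su sv] s2 /(size_leq_coef0 su) su' /(size_leq_coef0 sv) sv'.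
case: n1 {su sv} su' sv' => [|m] su sv; last first.
  by exists m => //; apply: HasBasis L1 L2 c0 det _ s2; rewrite /short su.
have u10 : u1 = 0 by apply/eqP; rewrite -size_poly_leq0.
have v10 : v1 = 0 by apply/eqP; rewrite -size_poly_leq0; move: sv; rewrite size_XnM_leq.
by have /eqP[] := basis_det_neq0 c0; rewrite -det u10 v10 mul0r mulr0 subr0.
Qed.

(* The determinant has degree [d], so that for [i + d < n1 + n2] the top
   coefficients of the two vectors are proportional. *)
Lemma shorten_basis o n1 n2 :
  (n1 <= n2)%N -> (i + d < n1 + n2)%N -> has_basis o n1 n2 ->
  exists m1 m2, (m1 + m2).+1 = (n1 + n2)%N /\ has_basis o m1 m2.
Proof.
move=> n12 big [u1 v1 u2 v2 c L1 L2 c0 det s1 s2].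
have [/andP[/eqP u1n /eqP v1n]|nz] := boolP ((u1`_n1 == 0) && (('X^i * v1)`_n1 == 0)).
  have [m n1E B] := shorten_first L1 L2 c0 det s1 s2 u1n v1n.
  by exists m, n2; rewrite n1E.
have [e [uE vE]] := proportional_pairs (basis_top_coefs big det s1 s2) nz.
case: n2 n12 big s2 uE vE => [|m] n12 big s2 uE vE; first by lia.
exists n1, m; split; first by rewrite addnS.
have [/andP[su1 sv1] /andP[su2 sv2]] := (s1, s2).
pose x := e *: 'X^(m.+1 - n1).
apply: (@HasBasis _ _ _ u1 v1 (u2 - x * u1) (v2 - x * v1) c) => //.
- by apply: in_latticeB => //; exact: in_latticeM.
- by rewrite -det; ring.
- rewrite /short cancel_top //= mulrBr mulrCA; exact: cancel_top.
Qed.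

Lemma has_basis_reduced o n1 n2 : (i + d <= n1 + n2)%N -> has_basis o n1 n2 ->
  exists m1 m2, reduced_basis o m1 m2.
Proof.
move=> /subnKC; move: (n1 + n2 - _)%N => e; elim: e n1 n2 => [|e IHe] n1 n2 n12 B.
  have {}n12 : (n1 + n2 = i + d)%N by lia.
  have [le12|/ltnW le21] := leqP n1 n2; first by exists n1, n2.
  by exists n2, n1; split=> //; [rewrite addnC | exact: has_basisC].
wlog le12 : n1 n2 n12 B / (n1 <= n2)%N.
  move=> W; have [|/ltnW] := leqP n1 n2; first exact: W.
  by apply: W; [rewrite n12 addnC | exact: has_basisC].
have [|m1 [m2 [m12 B']]] := shorten_basis le12 _ B; first by lia.
by apply: (IHe m1 m2) => //; lia.
Qed.

Lemma has_basis_infinity : has_basis None 0 (i + d).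
Proof.
apply: (@HasBasis _ _ _ 1 0 0 q 1); rewrite /in_lattice ?dvdp0 ?oner_neq0 //.
- by rewrite mul1r mulr0 subr0 scale1r.
- by rewrite /short size_poly1 mulr0 size_poly0.
- by rewrite /short size_poly0 size_XnM_leq sizeq; lia.
Qed.

Lemma has_basis_affine l n : (i <= n)%N -> (d <= n.+1)%N -> has_basis (Some l) d n.
Proof.
move=> le_in dn; apply: (@HasBasis _ _ _ q 0 (- val l) 1 1); rewrite ?oner_neq0 //=.
- by rewrite mulr0 addr0.
- by rewrite mulr1 addNr dvdp0.
- by rewrite mulr1 mulr0 subr0 scale1r.
- by rewrite /short sizeq mulr0 size_poly0 leqnn.
- rewrite /short size_polyN (leq_trans (size_npoly l)) // size_XnM_leq size_poly1.
  by lia.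
Qed.

Lemma ex_reduced_basis o : exists n1 n2, reduced_basis o n1 n2.
Proof.
case: o => [l|]; last by apply: has_basis_reduced has_basis_infinity.
by apply: (@has_basis_reduced _ d (i + d)); [lia | apply: has_basis_affine; lia].
Qed.

Lemma reduced_basis_infinity : reduced_basis None 0 (i + d).
Proof. by split=> //; exact: has_basis_infinity. Qed.

Lemma reduced_basis_affine l : (d <= i)%N -> reduced_basis (Some l) d i.
Proof. by move=> di; split; [| rewrite addnC | apply: has_basis_affine; lia]. Qed.

(* By Cramer's rule: the determinant of [(u, v)] and [(u1, v1)] is divisible by
   [q] and too short to be nonzero. *)
Lemma short_vector_multiple o n1 n2 u1 v1 u2 v2 (c : k) n u v :
  (n <= n2)%N -> (n1 + n2 = i + d)%N ->
  in_lattice o u1 v1 -> in_lattice o u2 v2 -> c != 0 -> u1 * v2 - u2 * v1 = c *: q ->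
  short n1.+1 u1 v1 -> short n2.+1 u2 v2 -> short n u v -> in_lattice o u v ->
  exists f, [/\ (size f <= n - n1)%N, u = f * u1 & v = f * v1].
Proof.
move=> nn2 n12 L1 L2 c0 det /andP[su1 sv1] /andP[su2 sv2] /andP[su sv] L.
have size_det m (w z w' z' : {poly k}) :
    (size w <= m)%N -> (size ('X^i * z)%R <= m)%N ->
    (size w' <= n)%N -> (size ('X^i * z')%R <= n)%N ->
    (size (w * z' - w' * z)%R <= (m + n).-1 - i)%N.
  move=> sw sz sw' sz'; rewrite -size_XnM_leq mulrBr !(mulrCA 'X^i).
  by apply: size_polyB_leq; [|rewrite addnC]; exact: size_polyM_leq.
have collinear : u1 * v = u * v1.
  apply/eqP; rewrite -subr_eq0; apply/eqP; apply: dvdp_small_eq0 (in_lattice_det L1 L).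
  by have := size_det _ _ _ _ _ su1 sv1 su sv; rewrite sizeq; lia.
have /dvdpP[w wE] := in_lattice_det L L2.
have cq0 := basis_det_neq0 c0; have q0 : q != 0 by rewrite -size_poly_gt0 sizeq.
have cancel a b : (c *: q) * a = b * (w * q) -> a = c^-1 *: w * b.
  move=> e; apply: (mulfI cq0); rewrite e -!scalerAl -scalerAr scalerA divff // scale1r.
  by ring.
exists (c^-1 *: w); split; last 2 first.
- by apply: cancel; rewrite -det -wE; ring: collinear.
- by apply: cancel; rewrite -det -wE; ring: collinear.
rewrite (leq_trans (size_scale_leq _ _)) //; have [->|w0] := eqVneq w 0.
  by rewrite size_poly0.
have := size_det _ _ _ _ _ su2 sv2 su sv.
by rewrite -opprB size_polyN wE size_polyM // sizeq; lia.
Qed.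

End ReducedBases.

(** * The folded binomial theorem *)

Lemma PoszX a n : (a ^ n)%N%:Z = a%:Z ^+ n.
Proof. by rewrite -!natz natrX. Qed.

Lemma fsumE (f : nat -> int) M : (forall k, (M <= k)%N -> f k = 0) ->
  fsum f = \sum_(k < M) f k.
Proof.
have ext M1 M2 : (M1 <= M2)%N -> (forall k, (M1 <= k)%N -> f k = 0) ->
    \sum_(k < M2) f k = \sum_(k < M1) f k.
  move=> M12 z; rewrite -(subnKC M12) big_split_ord /=.
  rewrite [X in _ + X]big1 ?addr0 // => k _.
  by rewrite z // leq_addr.
move=> fM; rewrite /fsum; case: excluded_middle_informative => [h|[]]; last by exists M.
case: constructive_indefinite_description => M' /= fM'.
by rewrite -(ext _ _ (leq_maxl M M') fM) -(ext _ _ (leq_maxr M M') fM').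
Qed.

Lemma sum_pascal (R : pzRingType) (G : nat -> nat -> R) d :
  \sum_(k < d.+1) 'C(d, k)%:R * (G (d - k).+1 k + G (d - k)%N k.+1) =
  \sum_(k < d.+2) 'C(d.+1, k)%:R * G (d.+1 - k)%N k.
Proof.
under eq_bigr => k _ do rewrite mulrDr -subSn ?(leq_ord k) //.
rewrite big_split /= [RHS]big_ord_recl.
under [X in _ = _ + X]eq_bigr => k _.
  rewrite lift0 binS natrD mulrDl subSS; over.
rewrite big_split /= addrA; congr (_ + _).
rewrite big_ord_recl [X in _ = _ + X]big_ord_recr /= (bin_small (ltnSn d)).
rewrite mul0r addr0 !bin0 !subn0.
by congr (_ + _); apply: eq_bigr => k _; rewrite lift0 subSS.
Qed.

Lemma sum_fold_middle (V : nmodType) (H : nat -> V) d :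
  \sum_(k < d.+1) H k =
  \sum_(k < d./2.+1) (if k.*2 == d then H k else H k + H (d - k)%N).
Proof.
have [n] := ubnP d; elim: n d H => // n IHn [|[|d]] H dn.
- by rewrite !big_ord1.
- by rewrite big_ord_recl !big_ord1.
rewrite [RHS]big_ord_recl big_ord_recr big_ord_recl /= -addrA [X in _ + X]addrC addrA.
rewrite (IHn d (fun k => H k.+1)); last by lia.
congr (_ + _); apply: eq_bigr => k _; rewrite /bump leq0n add1n doubleS !eqSS subSS.
by rewrite subSn //; have := ltn_ord k; lia.
Qed.

Section FoldedRay.
Variable p : nat.
Hypothesis p_gt0 : (0 < p)%N.

(* The isomorphism types form a ray [0, 1, 2, ...], which the matrix [N_1]
   identifies with a quotient of the line: [folded a b] is the image on the ray
   of [p ^ b] times the vertex [a - b] of the line, [reflected m] that of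
   [p ^ m] times the vertex [- m], and [reflected_tail m j] is the sum of
   [reflected m] over [j], [j + 2], [j + 4], ... *)
Definition reflected_tail m j : nat :=
  if (j <= m)%N && ~~ odd (m - j) then (p ^ minn m (m.+1 - j))%N else 0%N.

Definition reflected m j : nat := (reflected_tail m j - reflected_tail m j.+2)%N.

Definition folded a b j : nat :=
  (if b <= a then p ^ b * (a - b == j) else p ^ a * reflected (b - a) j)%N.

Definition nbr_count d i j : nat :=
  (if d == 0 then i == j : nat else folded (i + d) 0 j + folded i d j)%N.

(* Right multiplication of a row by [N_1]. *)
Definition ray_step (r : nat -> int) j : int :=
  (if j is j'.+1 then (1 + p%:Z * (j' == 0)%:Z) * r j' else 0) + p%:Z * r j.+1.

Lemma ray_stepD r s j : ray_step (fun j => r j + s j) j = ray_step r j + ray_step s j.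
Proof. by rewrite /ray_step; case: j => [|j]; ring. Qed.

Lemma ray_stepZ c r j : ray_step (fun j => c * r j) j = c * ray_step r j.
Proof. by rewrite /ray_step; case: j => [|j]; ring. Qed.

Lemma ray_step_sum n (F : nat -> nat -> int) j :
  ray_step (fun j => \sum_(e < n) F e j) j = \sum_(e < n) ray_step (F e) j.
Proof.
elim: n => [|n IHn].
  by rewrite big_ord0 /ray_step; case: j => [|j]; rewrite !big_ord0; ring.
rewrite [RHS]big_ord_recr /= -IHn -ray_stepD /ray_step.
by case: j {IHn} => [|j]; rewrite !big_ord_recr.
Qed.

Lemma eq_ray_step r s j : r =1 s -> ray_step r j = ray_step s j.
Proof. by move=> e; rewrite /ray_step; case: j => [|j]; rewrite !e. Qed.

Lemma ray_step_delta n j : ray_step (fun j => (n == j)%:Z) j =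
  (n.+1 == j)%:Z + p%:Z * (if n is n'.+1 then n' == j else 1 == j)%:Z.
Proof.
by rewrite /ray_step; case: n j => [|n] [|[|j]] /=; rewrite ?eqSS /=; ring.
Qed.

Lemma reflected_tail_leq m j : (reflected_tail m j.+2 <= reflected_tail m j)%N.
Proof.
rewrite /reflected_tail; case: ifP => // /andP[le ev].
by rewrite ifT ?leq_pexp2l //; lia.
Qed.

Lemma reflectedE m j :
  (reflected m j)%:Z = (reflected_tail m j)%:Z - (reflected_tail m j.+2)%:Z.
Proof. by rewrite subzn // reflected_tail_leq. Qed.

Lemma reflected0 j : reflected 0 j = (0 == j).
Proof. by case: j. Qed.

Lemma reflected1 j : reflected 1 j = (p * (1 == j))%N.
Proof.
by case: j => [|[|j]]; rewrite /reflected /reflected_tail /= ?muln0 ?muln1 ?subn0.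
Qed.

Lemma reflected_tail0 m : reflected_tail m 0 = (~~ odd m * p ^ m)%N.
Proof.
by rewrite /reflected_tail !subn0 /= (minn_idPl (leqnSn m)); case: odd; rewrite ?mul1n.
Qed.

Lemma reflected_tail1 m : reflected_tail m 1 = (odd m * p ^ m)%N.
Proof.
case: m => [|m]; rewrite /reflected_tail // !subn1 /= minnn.
by case: odd; rewrite ?mul1n.
Qed.

Lemma reflected_tailSS m j : reflected_tail m.+1 j.+2 = reflected_tail m j.+1.
Proof.
by rewrite /reflected_tail !subSS ltnS; case: ifP => // _; congr (p ^ _)%N; lia.
Qed.

Lemma ray_step_reflected m j : ray_step (fun j => (reflected m.+1 j)%:Z) j =
  p%:Z * (reflected m j)%:Z + (reflected m.+2 j)%:Z.
Proof.
rewrite /ray_step; case: j => [|[|j]];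
  rewrite !reflectedE !reflected_tailSS /=; last by ring.
  rewrite !reflected_tail0 !reflected_tail1 !PoszM !PoszX !exprS /=.
  by case: odd => /=; ring.
rewrite reflected_tail0 !reflected_tail1 !PoszM !PoszX !exprS /=.
by case: odd => /=; ring.
Qed.

Lemma ray_step_folded a b j : ray_step (fun j => (folded a b j)%:Z) j =
  (folded a.+1 b j)%:Z + (folded a b.+1 j)%:Z.
Proof.
rewrite /folded; have [ba|ab] := leqP b a; last first.
  have [m abE] : exists m, (b - a = m.+1)%N by exists (b - a).-1; lia.
  have -> : (b.+1 <= a)%N = false by lia.
  have -> : (b.+1 - a = m.+2)%N by lia.
  rewrite abE; under eq_ray_step => x do rewrite PoszM.
  rewrite ray_stepZ ray_step_reflected mulrDr PoszM; congr (_ + _).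
  rewrite mulrA [_ * p%:Z]mulrC -PoszM -expnS; have [ba|ab'] := leqP b a.+1.
    have -> : m = 0 by lia.
    by have -> : b = a.+1 by [lia]; rewrite subnn reflected0 PoszM.
  by have -> : (b - a.+1 = m)%N by [lia]; rewrite PoszM.
rewrite (leq_trans ba) //; under eq_ray_step => x do rewrite PoszM.
rewrite ray_stepZ ray_step_delta mulrDr PoszM subSn //; congr (_ + _).
rewrite mulrA [_ * p%:Z]mulrC -PoszM -expnS; have [ltba|leab] := ltnP b a.
  by have -> : (a - b = (a - b.+1).+1)%N by [lia]; rewrite PoszM.
have -> : a = b by lia.
by rewrite subnn subSnn reflected1 mulnA -expnSr PoszM.
Qed.

Lemma folded_delta a j : folded a 0 j = (a == j).
Proof. by rewrite /folded subn0 mul1n. Qed.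

Lemma nbr_count_leq d i j : (0 < d <= i)%N ->
  nbr_count d i j = ((i + d == j) + p ^ d * (i - d == j))%N.
Proof.
by case/andP=> d0 di; rewrite /nbr_count (gtn_eqF d0) folded_delta /folded di.
Qed.

Lemma nbr_count_gt d i j : (i < d)%N ->
  nbr_count d i j = ((i + d == j) + p ^ i * reflected (d - i) j)%N.
Proof.
case: d => // d lt_id.
by rewrite /nbr_count folded_delta /folded leqNgt lt_id.
Qed.

Lemma nbr_count1_0 j : nbr_count 1 0 j = ((1 == j) + p * (1 == j))%N.
Proof. by rewrite nbr_count_gt // mul1n reflected1. Qed.

Lemma foldedD a b m j : folded (a + m) (b + m) j = (p ^ m * folded a b j)%N.
Proof.
rewrite /folded leq_add2r !subnDr !expnD; case: ifP => _;
  by rewrite mulnAC mulnC mulnA.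
Qed.

Local Notation N1 := (fun a b => (nbr_count 1 a b)%:Z).

Lemma imul_ray_step (B : imat) i j : imul B N1 i j = ray_step (B i) j.
Proof.
have N1E k : N1 k j = ray_step (fun j => (k == j)%:Z) j.
  have := ray_step_folded k 0 j; under eq_ray_step => x do rewrite folded_delta.
  by rewrite /nbr_count addn1 PoszD => ->.
rewrite /imul (@fsumE _ j.+2) => [|k jk]; last first.
  rewrite N1E ray_step_delta (gtn_eqF (leqW (ltnW jk))) add0r.
  by case: k jk => [|k] //= jk; rewrite gtn_eqF ?mulr0.
under eq_bigr => k _ do rewrite N1E -ray_stepZ.
rewrite -(ray_step_sum _ (fun k j' => B i k * (k == j')%:Z)).
have row j' : (j' < j.+2)%N -> \sum_(k < j.+2) B i k * (nat_of_ord k == j')%:Z = B i j'.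
  move=> jj; rewrite (bigD1 (Ordinal jj)) //= eqxx mulr1 big1 ?addr0 // => k nk.
  by rewrite (_ : (nat_of_ord k == j') = false) ?mulr0 //; apply: contraNF nk.
by rewrite /ray_step; case: j {N1E} row => [|j] row; rewrite !row //; lia.
Qed.

Lemma ipow_folded d i j :
  ipow N1 d i j = \sum_(k < d.+1) 'C(d, k)%:R * (folded (i + (d - k))%N k j)%:Z.
Proof.
elim: d j => [|d IHd] j; first by rewrite big_ord1 addn0 folded_delta mul1r.
rewrite [LHS]imul_ray_step (eq_ray_step _ IHd).
rewrite (ray_step_sum _ (fun k j => 'C(d, k)%:R * (folded (i + (d - k))%N k j)%:Z)).
rewrite -(sum_pascal (fun a b => (folded (i + a) b j)%:Z)); apply: eq_bigr => k _.
by rewrite ray_stepZ ray_step_folded addnS.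
Qed.

(* The binomial theorem for [N_1], with the vertices [i + d - 2 k] and
   [i - (d - 2 k)] of the line collected in pairs. *)
Lemma ipow_nbr_count d i j : ipow N1 d i j =
  \sum_(k < d./2.+1) ('C(d, k) * p ^ k)%:Z * (nbr_count (d - k.*2)%N i j)%:Z.
Proof.
rewrite ipow_folded.
rewrite (sum_fold_middle (fun k => 'C(d, k)%:R * (folded (i + (d - k))%N k j)%:Z)).
apply: eq_bigr => k _; have k2d : (k.*2 <= d)%N by have := ltn_ord k; lia.
have dk : (d - k = d - k.*2 + k)%N by lia.
have upE : (folded (i + (d - k)) k j = p ^ k * folded (i + (d - k.*2)) 0 j)%N.
  by rewrite -foldedD add0n -addnA -dk.
have downE : (folded (i + (d - (d - k))) (d - k) j = p ^ k * folded i (d - k.*2) j)%N.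
  by rewrite -foldedD -dk; congr folded; lia.
rewrite /nbr_count subn_eq0; case: ifP => [/eqP k2|nk2].
  by rewrite k2 leqnn upE k2 subnn addn0 folded_delta natz -!PoszM mulnA.
have -> : (d <= k.*2)%N = false by lia.
rewrite bin_sub; last by lia.
by rewrite upE downE natz -mulrDr -PoszD -mulnDr -!PoszM mulnA.
Qed.

Lemma nbr_count_recurrence d i j : (nbr_count d i j)%:Z = ipow N1 d i j -
  \sum_(1 <= k < (d./2).+1) ('C(d, k) * p ^ k)%:Z * (nbr_count (d - k.*2)%N i j)%:Z.
Proof.
rewrite ipow_nbr_count big_add1 big_mkord big_ord_recl /= bin0 mul1n mul1r double0 subn0.
under [in RHS]eq_bigr => k _ do rewrite /bump leq0n add1n.
by rewrite addrK.
Qed.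

End FoldedRay.

(** * Counting lattices by their first minimum *)

Section Counting.
Variables (k : finFieldType) (q : {poly k}) (d i : nat).
Hypotheses (irr : irreducible_poly q) (sizeq : size q = d.+1).
Implicit Types (u v : {poly k}) (o : option {poly_d k}).

Let small_dvd_eq0 u : (size u <= d)%N -> q %| u -> u = 0.
Proof. by move=> su; apply: dvdp_small_eq0; rewrite sizeq. Qed.

Lemma unique_slope u v : (size v <= d)%N -> v != 0 ->
  exists l0 : {poly_d k}, forall l : {poly_d k}, (q %| u + val l * v) = (l == l0).
Proof.
move=> sv v0; have q0 := irredp_neq0 irr.
have nqv : ~~ (q %| v) by apply: contra v0 => /(small_dvd_eq0 sv) ->.
have sf l : (size ((u + l * v) %% q)%R <= d)%N by rewrite -ltnS -sizeq ltn_modp.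
pose f (l : {poly_d k}) := NPoly (sf (val l)).
have f_inj : injective f.
  move=> l l' /(congr1 val) /= /eqP; rewrite -subr_eq0 -modpN -modpD.
  rewrite opprD addrACA subrr add0r -mulrBl => qll'.
  apply/val_inj/eqP; rewrite -subr_eq0; apply/eqP/small_dvd_eq0.
    by apply: size_polyB_leq; exact: size_npoly.
  have : q %| (val l - val l') * v := qll'.
  by rewrite irreducible_dvdM // (negPf nqv) orbF.
have [g fK gK] := injF_bij f_inj; exists (g 0) => l.
by rewrite -(can2_eq fK gK) -val_eqE.
Qed.

Lemma unique_lattice u v : (size u <= d)%N -> (size v <= d)%N -> (u != 0) || (v != 0) ->
  exists o0 : option {poly_d k}, forall o, in_lattice q o u v = (o == o0).
Proof.
move=> su sv; have [->|v0 _] := eqVneq v 0.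
  rewrite orbF => u0; exists None => -[l|]; rewrite /in_lattice ?dvdp0 // mulr0 addr0.
  by apply: contraNF u0 => /(small_dvd_eq0 su) ->.
have [l0 l0P] := unique_slope u sv v0; exists (Some l0) => -[l|]; first exact: l0P.
by apply: contraNF v0 => /(small_dvd_eq0 sv) ->.
Qed.

Lemma card_lattices_through u v : (size u <= d)%N -> (size v <= d)%N ->
  #|[pred o : option {poly_d k} | in_lattice q o u v]| =
    (((u == 0) && (v == 0)) * #|k| ^ d).+1.
Proof.
move=> su sv; have [/andP[/eqP-> /eqP->]|] := boolP ((u == 0) && (v == 0)).
  rewrite mul1n -(card_npoly k d) -card_option; apply: eq_card => o.
  by case: o => [l|]; rewrite !inE /= ?mulr0 ?addr0 dvdp0.
rewrite negb_and => /(unique_lattice su sv)[o0 oP].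
by apply: (@eq_card1 _ o0) => o; rewrite !inE oP.
Qed.

Notation short_vector n := ({poly_n k} * {poly_(n - i) k})%type.

Lemma card_short_lattice_vectors o n1 n2 n : reduced_basis q i o n1 n2 -> (n <= n2)%N ->
  #|[pred w : short_vector n | in_lattice q o (val w.1) (val w.2)]| =
    (#|k| ^ (n - n1))%N.
Proof.
move=> [n12 sum_n [u1 v1 u2 v2 c L1 L2 c0 det s1 s2]] nn2.
have /andP[su1 sv1] := s1.
have size_mul (f : {poly_(n - n1) k}) (w : {poly k}) :
    (size w <= n1.+1)%N -> (size (val f * w)%R <= n)%N.
  have [n1n|] := ltnP n1 n; last rewrite -subn_eq0 => nn1.
    by move=> sw; apply: leq_trans (size_polyM_leq (size_npoly f) sw) _; lia.
  have f0 : val f = 0.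
    by apply/eqP; rewrite -size_poly_leq0 (leq_trans (size_npoly f)) // leqn0.
  by rewrite f0 mul0r size_poly0.
have size_mulX (f : {poly_(n - n1) k}) : (size (val f * v1)%R <= n - i)%N.
  by rewrite -size_XnM_leq mulrCA; exact: size_mul.
pose multiple f : short_vector n := (NPoly (size_mul f u1 su1), NPoly (size_mulX f)).
have multiple_inj : injective multiple.
  move=> f f' [/= eu ev]; apply: val_inj.
  have [u10|u10] := eqVneq u1 0; last exact: (mulIf u10).
  have [v10|v10] := eqVneq v1 0; last exact: (mulIf v10).
  have := basis_det_neq0 sizeq c0; rewrite -det u10 v10 mul0r mulr0 subr0.
  by rewrite eqxx.
rewrite -card_npoly -(card_imset _ multiple_inj) -[RHS]cardsE; apply: eq_card => -[u v].
rewrite !inE /=; apply/idP/imsetP => [L|[f _ [-> ->]]]; last exact: in_latticeM.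
have s : short i n (val u) (val v) by rewrite /short size_XnM_leq !size_npoly.
have [f [sf uE vE]] := short_vector_multiple sizeq nn2 sum_n L1 L2 c0 det s1 s2 s L.
by exists (NPoly sf) => //; congr (_, _); apply: val_inj.
Qed.

Variable min_weight : option {poly_d k} -> nat.
Hypothesis min_weightP :
  forall o, exists n2, reduced_basis q i o (min_weight o) n2.
Hypothesis lt_id : (i < d)%N.

(* Both sides count the pairs of a lattice and a vector [(u, v)] in it with
   [size u <= n] and [size v <= n - i]. *)
Lemma sum_short_vectors n : (2 * n <= i + d + 1)%N ->
  (\sum_o #|k| ^ (n - min_weight o) = #|k| ^ d + #|k| ^ (n + (n - i)))%N.
Proof.
move=> n2; pose incident (o : option {poly_d k}) (w : short_vector n) : nat :=
    in_lattice q o (val w.1) (val w.2).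
transitivity (\sum_o \sum_w incident o w)%N.
  apply: eq_bigr => o _; have [m2 B] := min_weightP o.
  have [le12 sum12 _] := B; rewrite -(card_short_lattice_vectors B); last by lia.
  by rewrite -sum1_card big_mkcond.
rewrite exchange_big /= (bigD1 (0, 0)) //=.
have through w : (\sum_o incident o w = ((w == (0, 0)%R) * #|k| ^ d).+1)%N.
  have := @card_lattices_through (val w.1) (val w.2).
  rewrite -sum1_card big_mkcond /= => ->; first by [].
    by apply: leq_trans (size_npoly _) _; lia.
  by apply: leq_trans (size_npoly _) _; lia.
rewrite through eqxx mul1n (eq_bigr (fun=> 1%N)) => [|w /negPf w0]; last first.
  by rewrite through w0.
rewrite sum1_card (cardC1 ((0, 0) : short_vector n)) card_prod !card_npoly -expnD.
rewrite addSnnS prednK //.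
by rewrite expn_gt0; apply/orP; left; apply/card_gt0P; exists 0.
Qed.

Let card_k_gt1 : (1 < #|k|)%N.
Proof. by rewrite (cardD1 0) (cardD1 1) !inE oner_neq0. Qed.

Lemma card_min_weight_gt n : (2 * n < i + d)%N ->
  (#|[pred o | n < min_weight o]| + (i <= n) * #|k| ^ (2 * n + 1 - i) = #|k| ^ d)%N.
Proof.
move=> nid; set x := #|_|.
have recur : (#|k| * (\sum_o #|k| ^ (n - min_weight o)) =
    \sum_o #|k| ^ (n.+1 - min_weight o) + (#|k| - 1) * x)%N.
  have -> : x = (\sum_o (n < min_weight o : nat))%N.
    by rewrite /x -[LHS]sum1_card big_mkcond.
  rewrite !big_distrr -big_split /=.
  apply: eq_bigr => o _; have [gt|le] := ltnP n (min_weight o).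
    have [-> ->] : (n - min_weight o = 0 /\ n.+1 - min_weight o = 0)%N by lia.
    by rewrite !expn0 !muln1 subnKC // ltnW // card_k_gt1.
  by rewrite muln0 addn0 subSn // expnS.
have k1 : (0 < #|k| - 1)%N by rewrite subn_gt0 card_k_gt1.
apply/eqP; rewrite -(eqn_pmul2l k1); apply/eqP.
move: recur; rewrite !sum_short_vectors; [|lia..].
have [le_in|lt_ni] := leqP i n; last first.
  have [-> ->] : (n.+1 + (n.+1 - i) = n.+1 /\ n + (n - i) = n)%N by lia.
  by rewrite mul0n addn0 expnS; nia.
pose e := (2 * n - i)%N.
have [-> ->] : (n.+1 + (n.+1 - i) = e.+2 /\ n + (n - i) = e)%N by lia.
have -> : (2 * n + 1 - i = e.+1)%N by lia.
by rewrite mul1n !expnS; nia.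
Qed.

Let card_lattices : #|{: option {poly_d k}}| = (#|k| ^ d + 1)%N.
Proof. by rewrite card_option card_npoly addn1. Qed.

Lemma card_min_weight_leq n : (2 * n <= i + d)%N ->
  #|[pred o | min_weight o <= n]%N| =
    (1 + #|k| ^ i * reflected_tail #|k| (d - i) (i + d - 2 * n))%N.
Proof.
rewrite leq_eqVlt => /predU1P[eq_n|lt_n].
  rewrite eq_n subnn reflected_tail0 (_ : odd (d - i) = false) ?mul1n -?expnD; last by lia.
  rewrite subnKC ?(ltnW lt_id) // addnC -card_lattices; apply: eq_card => o.
  by have [m [le12 sum12 _]] := min_weightP o; rewrite !inE; lia.
have -> : (#|k| ^ i * reflected_tail #|k| (d - i) (i + d - 2 * n) =
    (i <= n) * #|k| ^ (2 * n + 1 - i))%N.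
  rewrite /reflected_tail; have [le_in|lt_ni] := leqP i n.
    by rewrite ifT -?expnD ?mul1n; [congr (_ ^ _)%N; lia | lia].
  by rewrite ifF ?muln0 //; lia.
have : (#|[pred o | min_weight o <= n]| + #|[pred o | n < min_weight o]| =
    #|k| ^ d + 1)%N.
  rewrite -card_lattices -(cardC [pred o | min_weight o <= n]%N); congr addn.
  by apply: eq_card => o; rewrite !inE ltnNge.
by have := card_min_weight_gt lt_n; lia.
Qed.

Lemma card_min_weight_eq n : (2 * n <= i + d)%N ->
  #|[pred o | min_weight o == n]| = nbr_count #|k| d i (i + d - 2 * n)%N.
Proof.
move=> n2; set j := (i + d - 2 * n)%N.
rewrite (nbr_count_gt _ _ lt_id).
have := card_min_weight_leq n2; rewrite -/j /reflected mulnBr.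
case: n n2 @j => [|n] n2 j cardS.
  have -> : reflected_tail #|k| (d - i) j.+2 = 0%N.
    by rewrite /reflected_tail ifF //; lia.
  rewrite muln0 subn0 (_ : (i + d == j) = true) -?cardS; last by lia.
  by apply: eq_card => o; rewrite !inE leqn0.
have := card_min_weight_leq (leq_trans (leq_mul (leqnn 2) (leqnSn n)) n2).
have -> : (i + d - 2 * n = j.+2)%N by lia.
rewrite (_ : (i + d == j) = false) ?add0n => [cardn|]; last by lia.
have -> : #|[pred o | min_weight o == n.+1]| =
    (#|[pred o | min_weight o <= n.+1]%N| - #|[pred o | min_weight o <= n]%N|)%N.
  rewrite -(cardID [pred o | min_weight o <= n]%N [pred o | min_weight o <= n.+1]%N).
  rewrite (@eq_card _ (predI _ _) [pred o | min_weight o <= n]%N) ?addKn => [|o].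
    by apply: eq_card => o; rewrite !inE; lia.
  by rewrite !inE; lia.
by rewrite cardS cardn subnDl.
Qed.

Lemma card_lattices_of_type j :
  #|[pred o | i + d - 2 * min_weight o == j]%N| = nbr_count #|k| d i j.
Proof.
have min_weight_half o : (2 * min_weight o <= i + d)%N.
  by have [m [le12 sum12 _]] := min_weightP o; lia.
have [/existsP[n /eqP jE]|no_n] :=
    boolP [exists n : 'I_(i + d).+1, i + d == j + 2 * n]%N.
  have -> : j = (i + d - 2 * n)%N by lia.
  rewrite -card_min_weight_eq; last by lia.
  by apply: eq_card => o; rewrite !inE; have := min_weight_half o; lia.
have {}no_n n : (i + d)%N <> (j + 2 * n)%N.
  move=> jE; have lt_n : (n < (i + d).+1)%N by lia.
  by case/existsP: no_n; exists (Ordinal lt_n); apply/eqP.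
rewrite (nbr_count_gt _ _ lt_id).
have tail_eq0 m : (m = 0 \/ m = 2)%N -> reflected_tail #|k| (d - i) (m + j) = 0%N.
  move=> m2; rewrite /reflected_tail ifF //; apply/negP => /andP[le ev].
  by apply: (no_n (i + d - j)./2); lia.
rewrite /reflected (tail_eq0 0%N (or_introl erefl)) (tail_eq0 2%N (or_intror erefl)).
rewrite muln0 (_ : (i + d == j) = false); last first.
  by apply/negP => /eqP idj; apply: (no_n 0%N); lia.
apply: eq_card0 => o; rewrite !inE; apply/negP => /eqP jE.
by apply: (no_n (min_weight o)); have := min_weight_half o; lia.
Qed.

End Counting.

(** * Isomorphism types of the neighbors *)

Section LatticeMatrices.
Variables (k F : fieldType) (t : {rmorphism {poly k} -> F}).
Hypothesis t_eq0 : forall a, (t a == 0) = (a == 0).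
Hypothesis t_frac : forall f, exists (a b : {poly k}), b != 0 /\ f = t a / t b.
Implicit Types (l q u v : {poly k}).

Let t_neq0 a : a != 0 -> t a != 0. Proof. by rewrite t_eq0. Qed.
Let tX0 : t 'X != 0. Proof. by rewrite t_neq0 ?polyX_eq0. Qed.
Notation y := ((t 'X)^-1).
Let y0 : y != 0. Proof. by rewrite invr_eq0. Qed.

Lemma scaledGL_lattice q d (o : option {poly_d k}) u1 v1 u2 v2 (c : k) :
  irreducible_poly q -> in_lattice q o u1 v1 -> in_lattice q o u2 v2 -> c != 0 ->
  u1 * v2 - u2 * v1 = c *: q ->
  scaledGL (finO t q) (nbr_mx (fun l : {poly_d k} => t (val l)) (t q) o *
    map_mx t (mx2 u1 u2 v1 v2)).
Proof.
move=> irr L1 L2 c0 det; have q0 := irredp_neq0 irr.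
set N : 'M[{poly k}]_2 := nbr_mx val q o.
have -> : nbr_mx (fun l : {poly_d k} => t (val l)) (t q) o = map_mx t N.
  by rewrite /N; case: (o) => [l|]; rewrite map_mx2 ?rmorph1 ?rmorph0.
have [B BE] : exists B, N * mx2 u1 u2 v1 v2 = q *: B.
  rewrite /N; case: (o) L1 L2 => [l|] /= /dvdpP[w1 w1E] /dvdpP[w2 w2E].
    exists (mx2 w1 w2 v1 v2); rewrite mx2M mx2Z !mul1r w1E w2E.
    by congr mx2; ring.
  exists (mx2 u1 u2 w1 w2); rewrite mx2M mx2Z w1E w2E.
  by congr mx2; ring.
have detB : \det B = c%:P.
  have /(congr1 determinant) := BE; rewrite det_mulmx detZ det_nbr_mx det_mx2 det.
  by rewrite -mul_polyC mulrCA [in RHS]mulrC -expr2 => /(mulIf (expf_neq0 2 q0)).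
rewrite [_ * _](esym (map_mxM t N _)) [_ *m _]BE map_mxZ.
apply: scaledGLZ; first exact: t_neq0.
apply/intGL_scaled/(intGL_finO t_eq0 t_frac) => //.
by rewrite detB -alg_polyC dvdpZr // irreducible_dvd1.
Qed.

Lemma scaledGL_infO_lattice q d i n1 n2 u1 v1 u2 v2 (c : k) :
  size q = d.+1 -> (n1 <= n2)%N -> (n1 + n2 = i + d)%N ->
  c != 0 -> u1 * v2 - u2 * v1 = c *: q -> short i n1.+1 u1 v1 -> short i n2.+1 u2 v2 ->
  scaledGL (infO t) (diag2 (y ^+ i) * map_mx t (mx2 u1 u2 v1 v2) *
    (diag2 (y ^+ (n2 - n1)))^-1).
Proof.
move=> sizeq n12 sum12 c0 det /andP[su1 sv1] /andP[su2 sv2].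
have tXi0 n : t 'X^n != 0 by rewrite t_neq0 ?expf_neq0 ?polyX_eq0.
have yE n : y ^+ n = (t 'X^n)^-1 by rewrite exprVn rmorphXn.
rewrite diag2V ?expf_neq0 // !yE invrK map_mx2 /diag2 !mx2M.
rewrite (_ : mx2 _ _ _ _ = (t 'X^n2 / t 'X^i) *: mx2 (t u1 / t 'X^n1) (t u2 / t 'X^n2)
    (t ('X^i * v1) / t 'X^n1) (t ('X^i * v2) / t 'X^n2)); last first.
  rewrite mx2Z; have -> : t 'X^n2 = t 'X^(n2 - n1) * t 'X^n1.
    by rewrite -rmorphM -exprD subnK.
  by rewrite !rmorphM; congr mx2; field; rewrite ?tXi0 ?oner_neq0.
apply: scaledGLZ; first by rewrite mulf_neq0 ?invr_eq0.
apply/intGL_scaled/(intGL_det (infO_dvr t_eq0 t_frac)); rewrite det_mx2.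
have -> : t u1 / t 'X^n1 * (t ('X^i * v2) / t 'X^n2) -
    t u2 / t 'X^n2 * (t ('X^i * v1) / t 'X^n1) = t ('X^i * (c *: q)) / t 'X^(i + d).
  by rewrite -det -sum12 exprD !rmorphM rmorphB !rmorphM; field; rewrite !tXi0.
have q0 : c *: q != 0 by rewrite scale_poly_eq0 negb_or c0 -size_poly_gt0 sizeq.
have size_num : size ('X^i * (c *: q)) = (i + d).+1.
  by rewrite mulrC size_mulXn // size_scale // sizeq addnS.
have num0 : 'X^i * (c *: q) != 0 by rewrite -size_poly_gt0 size_num.
split.
- by apply: intM_mx2; apply/(infO_Xn t_eq0).
- exact: mulf_neq0 (t_neq0 num0) (invr_neq0 (tXi0 _)).
- rewrite invf_div; by apply/(infO_frac t_eq0); rewrite ?size_num ?size_polyXn.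
Qed.

Lemma nbr_infinity_diag2 i :
  diag2 y * diag2 (y ^+ i) * 1 * (diag2 (y ^+ i.+1))^-1 = 1.
Proof.
by rewrite mulr1 diag2V ?expf_neq0 // !diag2M -exprS divff ?expf_neq0 // mx2_1.
Qed.

Lemma nbr_affine_diag2S i l :
  mx2 1 (t l) 0 y * diag2 (y ^+ i.+1) *
    map_mx t (mx2 1 (- (l * 'X^(i.+1))) 0 1) * (diag2 (y ^+ i))^-1 = y *: 1.
Proof.
rewrite diag2V ?expf_neq0 // map_mx2 /diag2 !mx2M mx2_1 mx2Z.
rewrite !(rmorph0, rmorph1, rmorphN, rmorphM, rmorphXn) /= !exprVn !exprS.
by congr mx2; field; rewrite ?(expf_neq0 _ tX0) ?tX0 ?oner_neq0.
Qed.

Lemma nbr_affine_diag2_0 l :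
  mx2 1 (t l) 0 y * diag2 (y ^+ 0) * map_mx t (mx2 (- l) 1 1 0) * (diag2 (y ^+ 1))^-1 =
    mx2 0 1 1 0.
Proof.
rewrite diag2V ?expf_neq0 // map_mx2 /diag2 !mx2M.
rewrite !(rmorph0, rmorph1, rmorphN) /= expr0 expr1 invrK.
by congr mx2; field; rewrite ?tX0.
Qed.

Lemma infO_Xn_eq0 a m n : (m < n)%N -> infO t (t ('X^n * a) / t 'X^m) -> a = 0.
Proof.
move=> mn; rewrite infO_Xn // size_XnM_leq => sz.
by apply/eqP; rewrite -size_poly_leq0 (leq_trans sz) //; lia.
Qed.

(* The conjugate of the nilpotent matrix would have polynomial entries, all of
   which are too small at infinity to be nonzero. *)
Lemma nilpotent_not_conj_order (h : 'M[F]_2) i j : h \in unitmx -> (i < j)%N ->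
  (forall q, q \is monic -> irreducible_poly q ->
     intM (finO t q) (h^-1 * mx2 0 1 0 0 * h)) ->
  ~ conj_order (infO t) (diag2 (y ^+ i)) (h^-1 * mx2 0 (t 'X^j) 0 0 * h).
Proof.
move=> uh ij fin.
have -> : mx2 0 (t 'X^j) 0 0 = t 'X^j *: mx2 0 1 0 0 by rewrite mx2Z !mulr0 mulr1.
rewrite -scalerAr -scalerAl; move E: (h^-1 * _ * h) fin => m fin.
have poly r s : exists a, m r s = t a.
  by apply: (finO_everywhere_poly t_eq0 t_frac) => q mq iq; exact: fin.
move/(conj_order_diag2 (infO_dvr t_eq0 t_frac)); rewrite !mxE exprVn -rmorphXn invrK.
have [a aE] := poly 0 0; have [b bE] := poly 0 1.
have [c cE] := poly 1 0; have [d dE] := poly 1 1.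
rewrite aE bE cE dE -!rmorphM => -[Oa Ob Oc Od].
have m0 : m = 0.
  have j0 : (0 < j)%N by exact: leq_ltn_trans ij.
  have X0E f : t f = t f / t 'X^0 by rewrite rmorph1 divr1.
  rewrite X0E in Oa; rewrite X0E mulrAC -exprD in Oc; rewrite X0E in Od.
  rewrite [m]mx2_eta aE bE cE dE (infO_Xn_eq0 j0 Oa) (infO_Xn_eq0 ij Ob).
  rewrite (infO_Xn_eq0 (ltn_addr i j0) Oc) (infO_Xn_eq0 j0 Od) !rmorph0.
  by rewrite [RHS]mx2_eta !mxE.
have /matrixP/(_ 0 1) : mx2 0 1 0 0 = h * m * h^-1 by rewrite -E conjmxVK.
by rewrite m0 mulr0 mul0r mx2E mxE => /eqP; rewrite oner_eq0.
Qed.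

End LatticeMatrices.

Section IsomorphismTypes.
Variable p : nat.
Implicit Types (P Q R : option {poly 'F_p}) (D : Xfam p).

(* [fam (diag_inf i)] is the family of stalks of [D_(i oo)]. *)
Definition diag_inf (i : nat) R : Mat p :=
  if R is None then diag2 (unif None ^+ i) else 1.

Lemma unitmx_diag_inf i R : diag_inf i R \in unitmx.
Proof.
case: R => [q|]; first exact: unitmx1.
by apply/unitmx_diag2/expf_neq0; exact: (@unif_place_neq0 p None I).
Qed.

Lemma Xiso_diag_inf_leq i j : Xiso (fam (diag_inf i)) (fam (diag_inf j)) -> (j <= i)%N.
Proof.
move=> [h [uh eh]]; rewrite leqNgt; apply/negP => ij.
apply: (nilpotent_not_conj_order (@tfm_eq0 p) (@tfm_frac p) uh ij) => [q mq iq|].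
  have plq : is_place (Some q) by split.
  have D := place_dvr plq; have GL1 := intGL1 D 1.
  have [to_i _] := eh (Some q) plq (mx2 0 1 0 0).
  apply: (conj_order_intGL D _ GL1).1; apply: to_i; apply: (conj_order_intGL D _ GL1).2.
  by apply: intM_mx2; first [exact: dvr0 D | exact: dvr1 D].
have [to_i _] := eh None I (mx2 0 (tfm p 'X^j) 0 0).
have D := @place_dvr p None I.
apply: to_i; apply: (conj_order_diag2 D _ _).2; rewrite !mx2E mul0r.
split; try exact: dvr0 D.
have -> : tfm p 'X^j * unif None ^+ j = 1; last exact: dvr1 D.
rewrite rmorphXn -exprMn; have -> : tfm p 'X * unif None = 1; last exact: expr1n.
by apply: divff; rewrite tfm_eq0 polyX_eq0.
Qed.

Lemma Xiso_diag_inf_eq D i j :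
  Xiso D (fam (diag_inf i)) -> Xiso D (fam (diag_inf j)) <-> i = j.
Proof.
move=> isoi; split=> [isoj|<-//]; apply/eqP; rewrite eqn_leq.
rewrite (Xiso_diag_inf_leq (Xiso_trans (Xiso_sym isoj) isoi)).
by rewrite (Xiso_diag_inf_leq (Xiso_trans (Xiso_sym isoi) isoj)).
Qed.

(* Conjugation by [to_infinity Q i] carries [D_(iQ)] to [D_(i oo)]. *)
Definition to_infinity Q (i : nat) : Mat p :=
  if Q is Some y then diag2 (tfm p y ^+ i) else 1.

Lemma unitmx_to_infinity Q i : is_place Q -> to_infinity Q i \in unitmx.
Proof.
case: Q => [y [_ iy]|_]; last exact: unitmx1.
by apply/unitmx_diag2/expf_neq0; rewrite tfm_eq0 irredp_neq0.
Qed.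

Lemma intGL_diag_inf_to_infinity Q i R : is_place Q -> place_deg Q = 1%N ->
  is_place R -> R != Q -> intGL (locO R) (diag_inf i R * to_infinity Q i).
Proof.
move=> plQ dQ plR RQ; have D := place_dvr plR.
case: Q plQ dQ RQ => [y [my iy]|_] dQ RQ; last first.
  by case: R plR RQ D => [r|//] plR _ D; rewrite mulr1; exact: intGL1 D _.
have sizey : size y = 2 by rewrite (size_irredp iy) [(size y).-1]dQ.
have y0 := irredp_neq0 iy; have ty0 : tfm p y != 0 by rewrite tfm_eq0.
case: R plR RQ D => [r [mr ir]|plR] RQ D.
  rewrite mul1r; apply: (intGL_diag2 D); first exact: expf_neq0.
    by apply: (dvrX D); exact: (finO_poly (tfm p) y ir).
  rewrite -exprVn; apply: (dvrX D); rewrite -[_^-1]mul1r -(rmorph1 (tfm p)).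
  apply: finO_frac; apply: contra RQ => ry.
  by rewrite (monic_irreducible_eq mr ir my iy ry).
have -> : diag_inf i None * to_infinity (Some y) i = diag2 ((unif None * tfm p y) ^+ i).
  by rewrite exprMn; exact: diag2M.
have unitE : unif None * tfm p y = tfm p y / tfm p 'X by exact: mulrC.
rewrite unitE; apply: (intGL_diag2 D).
- exact: expf_neq0 (mulf_neq0 ty0 (unif_neq0 D)).
- apply: (dvrX D); apply/(infO_frac (@tfm_eq0 p)); first by rewrite polyX_eq0.
  by rewrite sizey size_polyX.
- rewrite -exprVn invf_div; apply: (dvrX D); apply/(infO_frac (@tfm_eq0 p)) => //.
  by rewrite sizey size_polyX.
Qed.

Definition diag_twist Q i R : Mat p := diag_inf i R * to_infinity Q i.

Lemma D_iQ_fam Q i : is_place Q -> place_deg Q = 1%N ->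
  Xeq (D_iQ Q i) (fam (diag_twist Q i)).
Proof.
move=> plQ dQ R plR x; rewrite /D_iQ /fam; case: eqVneq => [->|RQ].
  apply: iff_trans (valmatE i x plQ) _.
  have -> // : diag_twist Q i Q = diag2 (unif Q ^+ i).
  by rewrite /diag_twist; case: (Q) => [y|]; [exact: mul1r | exact: mulr1].
apply: iff_trans (M2OE R x) (iff_sym _).
have GLR := intGL_diag_inf_to_infinity i plQ dQ plR RQ.
exact: (conj_order_intGL (place_dvr plR) x GLR).
Qed.

Lemma adelic_diag_twist Q i : is_place Q -> place_deg Q = 1%N ->
  adelic (diag_twist Q i).
Proof.
move=> plQ dQ; split=> [R _|].
  exact: unitmx_mulr (unitmx_diag_inf i R) (unitmx_to_infinity i plQ).
by exists [:: Q] => R plR; rewrite inE; exact: intGL_diag_inf_to_infinity.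
Qed.

Lemma Xiso_fam_mulr (a b : option {poly 'F_p} -> Mat p) (g : Mat p) :
  (forall R, is_place R -> a R \in unitmx) -> g \in unitmx ->
  (forall R, is_place R -> b R = a R * g) -> Xiso (fam b) (fam a).
Proof.
move=> ua ug bE; exists g; split; first exact: ug.
move=> R plR x; rewrite /fam (bE R plR); apply: iff_sym.
apply: iff_trans (conj_orderM _ _ (ua R plR) ug) _.
by rewrite [X in conj_order _ _ X <-> _](conjmxVK x ug).
Qed.

Lemma Xiso_D_iQ Q i : is_place Q -> place_deg Q = 1%N ->
  Xiso (D_iQ Q i) (fam (diag_inf i)).
Proof.
move=> plQ dQ; apply: Xiso_trans (Xeq_Xiso (D_iQ_fam i plQ dQ)) _.
exact: (Xiso_fam_mulr (fun R _ => unitmx_diag_inf i R) (unitmx_to_infinity i plQ)).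
Qed.

Lemma N_is_type Q P i j (typ : option {poly_(place_deg P) 'F_p} -> nat) :
  is_place Q -> place_deg Q = 1%N -> is_place P ->
  (forall o, Xiso (fam (@nbr_at p (diag_inf i) P o)) (fam (diag_inf (typ o)))) ->
  N_is P (D_iQ Q i) (D_iQ Q j) #|[pred o | typ o == j]|.
Proof.
move=> plQ dQ plP typP.
apply: (N_is_card plP (adelic_diag_twist i plQ dQ) (D_iQ_fam i plQ dQ)) => o.
have isoo : Xiso (fam (nbr_at (diag_twist Q i) o)) (fam (diag_inf (typ o))).
  apply: Xiso_trans (typP o).
  apply: (Xiso_fam_mulr _ (unitmx_to_infinity i plQ)) => R plR.
    exact: (unitmx_nbr_at o plP plR (fun R _ => unitmx_diag_inf i R)).
  by rewrite /nbr_at; case: eqP => // _; exact: mulrA.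
have isoj := Xiso_D_iQ j plQ dQ; rewrite inE; split=> [iso|/eqP ej].
  by apply/eqP/(Xiso_diag_inf_eq _ isoo); exact: Xiso_trans iso isoj.
by apply: Xiso_trans isoo _; rewrite ej; exact: Xiso_sym.
Qed.

Lemma Xiso_diag_inf (a : option {poly 'F_p} -> Mat p) j (A : 'M[{poly 'F_p}]_2) :
  (forall R, is_place R -> a R \in unitmx) -> \det A != 0 ->
  (forall R, is_place R ->
     scaledGL (locO R) (a R * map_mx (tfm p) A * (diag_inf j R)^-1)) ->
  Xiso (fam a) (fam (diag_inf j)).
Proof.
move=> ua detA GL; apply/(Xiso_famP ua (fun R _ => unitmx_diag_inf j R)).
exists (map_mx (tfm p) A); last exact: GL.
by rewrite unitmxE det_map_mx unitfE tfm_eq0.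
Qed.

Lemma scaledGL_diag_inf_finite i j (q : {poly 'F_p}) (A : 'M[{poly 'F_p}]_2) :
  irreducible_poly q -> ~~ (q %| \det A) ->
  scaledGL (locO (Some q))
    (diag_inf i (Some q) * map_mx (tfm p) A * (diag_inf j (Some q))^-1).
Proof.
move=> iq nq; rewrite /diag_inf invr1 mulr1 mul1r.
exact: intGL_scaled (intGL_finO (@tfm_eq0 p) (@tfm_frac p) iq nq).
Qed.

Lemma Xiso_nbr_at_lattice i n1 n2 (q : {poly 'F_p})
    (o : option {poly_((size q).-1) 'F_p}) :
  is_place (Some q) -> reduced_basis q i o n1 n2 ->
  Xiso (fam (@nbr_at p (diag_inf i) (Some q) o)) (fam (diag_inf (n2 - n1))).
Proof.
move=> plq [n12 sum12 [u1 v1 u2 v2 c L1 L2 c0 det s1 s2]]; have [mq iq] := plq.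
have detA : \det (mx2 u1 u2 v1 v2) = c *: q by rewrite det_mx2.
apply: (@Xiso_diag_inf _ _ (mx2 u1 u2 v1 v2)) => [R plR||[r|] plR].
- exact: (@unitmx_nbr_at _ _ (Some q) o _ plq plR (fun R _ => unitmx_diag_inf i R)).
- by rewrite detA scale_poly_eq0 negb_or c0 irredp_neq0.
- have [mr ir] := plR; rewrite /nbr_at; case: eqVneq => [[rq]|rq].
    rewrite rq /diag_inf mulr1 invr1 mulr1.
    exact: (scaledGL_lattice (@tfm_eq0 p) (@tfm_frac p) iq L1 L2 c0 det).
  apply: (scaledGL_diag_inf_finite i (n2 - n1) ir); rewrite detA dvdpZr //.
  by apply: contra rq => rq; rewrite (monic_irreducible_eq mr ir mq iq rq).
- exact: (scaledGL_infO_lattice (@tfm_eq0 p) (@tfm_frac p) (size_irredp iq)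
    n12 sum12 c0 det s1 s2).
Qed.

Lemma Xiso_nbr_at_infinity i j (o : option {poly_(place_deg None) 'F_p})
    (A : 'M[{poly 'F_p}]_2) : size (\det A) = 1%N ->
  scaledGL (locO None) (nbr_mx (@place_rep p None) (unif None) o * diag_inf i None *
    map_mx (tfm p) A * (diag_inf j None)^-1) ->
  Xiso (fam (@nbr_at p (diag_inf i) None o)) (fam (diag_inf j)).
Proof.
move=> size_det GLA; apply: (@Xiso_diag_inf _ _ A) => [R plR||[r|] plR].
- exact: (@unitmx_nbr_at _ _ None o _ I plR (fun R _ => unitmx_diag_inf i R)).
- by rewrite -size_poly_gt0 size_det.
- have [_ ir] := plR; apply: (scaledGL_diag_inf_finite i j ir).
  have det1 : \det A %= 1 by rewrite -size_poly_eq1 size_det.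
  by rewrite (eqp_dvdr _ det1) irreducible_dvd1.
- exact: GLA.
Qed.

Lemma Xiso_nbr_at_infinity_None i :
  Xiso (fam (@nbr_at p (diag_inf i) None None)) (fam (diag_inf i.+1)).
Proof.
apply: (@Xiso_nbr_at_infinity _ _ None 1); first by rewrite det1 size_poly1.
have -> : map_mx (tfm p) 1 = 1 by exact: map_mx1.
rewrite [X in scaledGL _ X](nbr_infinity_diag2 (@tfm_eq0 p) i : _ = 1).
exact: intGL_scaled (intGL1 (@place_dvr p None I) 1).
Qed.

Lemma Xiso_nbr_at_infinity_Some0 l :
  Xiso (fam (@nbr_at p (diag_inf 0) None (Some l))) (fam (diag_inf 1)).
Proof.
have D := @place_dvr p None I.
apply: (@Xiso_nbr_at_infinity _ _ (Some l) (mx2 (- val l) 1 1 0)).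
  by rewrite det_mx2 mulr0 mulr1 sub0r size_polyN size_poly1.
rewrite [X in scaledGL _ X](nbr_affine_diag2_0 (@tfm_eq0 p) (val l) : _ = mx2 0 1 1 0).
apply/intGL_scaled/(intGL_det D).
rewrite det_mx2 mul0r mul1r sub0r oppr_eq0 oner_neq0 invrN1.
split=> //; last exact: (dvrN D (dvr1 D)).
by apply: intM_mx2; first [exact: dvr0 D | exact: dvr1 D].
Qed.

Lemma Xiso_nbr_at_infinity_SomeS i l :
  Xiso (fam (@nbr_at p (diag_inf i.+1) None (Some l))) (fam (diag_inf i)).
Proof.
have D := @place_dvr p None I.
apply: (@Xiso_nbr_at_infinity _ _ (Some l) (mx2 1 (- (val l * 'X^(i.+1))) 0 1)).
  by rewrite det_mx2 mulr1 mulr0 subr0 size_poly1.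
have E := nbr_affine_diag2S (@tfm_eq0 p) i (val l).
rewrite [X in scaledGL _ X](E : _ = unif None *: 1).
exact: scaledGLZ (unif_neq0 D) (intGL_scaled (intGL1 D 1)).
Qed.

End IsomorphismTypes.

Lemma card_constant_type (T : finType) (a c j : nat) :
  #|[pred o : option T | (if o is Some _ then c else a) == j]| =
    ((a == j) + #|T| * (c == j))%N.
Proof.
case: (boolP (c == j)) => cj; case: (boolP (a == j)) => aj; rewrite ?muln1 ?muln0.
- by rewrite add1n -card_option; apply: eq_card => -[x|]; rewrite !inE ?cj ?aj.
- rewrite -[#|T|]/(#|T|.+1.-1) -card_option -(cardC1 None).
  by apply: eq_card => -[x|]; rewrite !inE ?cj // (negPf aj).
- by apply: (@eq_card1 _ None) => -[x|]; rewrite !inE ?(negPf cj) ?aj.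
- by apply: eq_card0 => -[x|]; rewrite !inE ?(negPf cj) ?(negPf aj).
Qed.

Section NeighborCount.
Variables (p : nat) (Q : option {poly 'F_p}) (i j : nat).
Hypotheses (p_prime : prime p) (plQ : is_place Q) (dQ : place_deg Q = 1%N).

Lemma N_is_nbr_count_infinity :
  N_is None (D_iQ Q i) (D_iQ Q j) (nbr_count p 1 i j).
Proof.
pose down := if i is i'.+1 then i' else 1%N.
have -> : nbr_count p 1 i j =
    #|[pred o : option {poly_1 'F_p} | (if o is Some _ then down else i.+1) == j]|.
  rewrite card_constant_type card_npoly card_Fp // expn1 /down.
  case: (i) => [|i']; first by rewrite nbr_count1_0.
  by rewrite nbr_count_leq // addn1 subn1 expn1.
apply: (@N_is_type p Q None i j _ plQ dQ I) => -[l|]; last first.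
  exact: Xiso_nbr_at_infinity_None.
rewrite /down; case: (i) => [|i']; first exact: Xiso_nbr_at_infinity_Some0.
exact: Xiso_nbr_at_infinity_SomeS.
Qed.

Lemma N_is_nbr_count_finite_leq q : is_place (Some q) -> ((size q).-1 <= i)%N ->
  N_is (Some q) (D_iQ Q i) (D_iQ Q j) (nbr_count p (size q).-1 i j).
Proof.
move=> plq di; have [_ iq] := plq; have [q1 _] := iq.
have d0 : (0 < (size q).-1)%N by rewrite -ltnS -(size_irredp iq).
have <- : #|[pred o : option {poly_((size q).-1) 'F_p} |
    (if o is Some _ then i - (size q).-1 else i + (size q).-1)%N == j]| =
    nbr_count p (size q).-1 i j.
  by rewrite card_constant_type card_npoly card_Fp // nbr_count_leq ?d0.
apply: (N_is_type _ plQ dQ plq) => -[l|].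
  exact: (Xiso_nbr_at_lattice plq (reduced_basis_affine (size_irredp iq) l di)).
rewrite -[(i + _)%N]subn0.
exact: (Xiso_nbr_at_lattice plq (reduced_basis_infinity i (size_irredp iq))).
Qed.

Lemma N_is_nbr_count_finite_gt q : is_place (Some q) -> (i < (size q).-1)%N ->
  N_is (Some q) (D_iQ Q i) (D_iQ Q j) (nbr_count p (size q).-1 i j).
Proof.
move=> plq id; have [_ iq] := plq.
have [m mP] := fin_all_exists (ex_reduced_basis i (size_irredp iq)).
have := card_lattices_of_type iq (size_irredp iq) mP id j; rewrite card_Fp // => <-.
apply: (N_is_type _ plQ dQ plq) => o; have [n2 red] := mP o.
have sum12 : (m o + n2 = i + (size q).-1)%N by case: red.
have -> : (i + (size q).-1 - 2 * m o = n2 - m o)%N by lia.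
exact: (Xiso_nbr_at_lattice plq red).
Qed.

Lemma N_is_nbr_count P : is_place P ->
  N_is P (D_iQ Q i) (D_iQ Q j) (nbr_count p (place_deg P) i j).
Proof.
case: P => [q|] plP; last exact: N_is_nbr_count_infinity.
have [di|lt_id] := leqP (size q).-1 i; first exact: N_is_nbr_count_finite_leq.
exact: N_is_nbr_count_finite_gt.
Qed.

End NeighborCount.

Theorem theorem5 (p : nat) (Q : option {poly 'F_p}) :
  prime p -> is_place Q -> place_deg Q = 1%N ->
  exists N : nat -> nat -> nat -> nat,
    [/\ (forall P, is_place P -> forall i j : nat,
           N_is P (D_iQ Q i) (D_iQ Q j) (N (place_deg P) i j)),
        (forall i j : nat, N 0%N i j = (i == j) :> nat)
      & (forall d : nat, (1 <= d)%N -> forall i j : nat,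
           (N d i j)%:Z =
             ipow (fun a b => (N 1%N a b)%:Z) d i j
             - \sum_(1 <= k < (d./2).+1)
                 ('C(d, k) * p ^ k)%:Z * (N (d - k.*2)%N i j)%:Z)].
Proof.
move=> p_prime plQ dQ; exists (nbr_count p); split=> [P plP i j|//|d _ i j].
- exact: N_is_nbr_count.
- exact: (nbr_count_recurrence (prime_gt0 p_prime)).
Qed.
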